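(* There is an algorithm which, given any convex $n$-gon $C$ with $n \ge 5$ (by the coordinates of its vertices $p_1,\dots,p_n$ in counterclockwise order), finds a minimum area convex polygon inscribed in $C$ in $O(n)$ steps.
   Context: A convex polygon $Q$ is inscribed in a convex polygon $C$ if every side of $C$ contains at least one vertex of $Q$. Set $a(C)=\inf\{\operatorname{area}(Q) : Q \text{ is inscribed in } C\}$. A minimum area convex polygon inscribed in $C$ is a convex polygon $Q$ inscribed in $C$ with $\operatorname{area}(Q)=a(C)$. Sides of polygons are closed segments. Steps are elementary operations on real numbers (arithmetic operations and comparisons), each of unit cost. *)

(* Defs.v *)
From HB Require Import structures.
From mathcomp Require Import all_boot all_order all_algebra.
From mathcomp Require Import all_classical all_reals all_analysis.

Set Implicit Arguments.
Unset Strict Implicit.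
Unset Printing Implicit Defensive.

Import Order.TTheory GRing.Theory Num.Theory.

Local Open Scope classical_set_scope.
Local Open Scope ring_scope.

Section ConvexPolygons.
Variable R : realType.
Implicit Types (a b c v : R * R) (C Q : seq (R * R)).

(* Twice the signed area of the triangle abc; it is positive iff a, b, c make
   a strict left turn. *)
Definition orient a b c : R :=
  (b.1 - a.1) * (c.2 - a.2) - (b.2 - a.2) * (c.1 - a.1).

(* A polygon is given by the sequence of its vertices. Requiring a left turn
   for all triples, not only for consecutive ones, excludes sequences that wind
   more than once around; strictness makes every listed point a genuine
   vertex. *)
Definition convex_polygon C : Prop :=
  (3 <= size C)%N /\
  forall i j k : nat, (i < j)%N -> (j < k)%N -> (k < size C)%N ->
    0 < orient C`_i C`_j C`_k.

Definition segment a b : set (R * R) :=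
  [set v | exists t : R, [/\ 0 <= t, t <= 1,
     v.1 = (1 - t) * a.1 + t * b.1 & v.2 = (1 - t) * a.2 + t * b.2]].

Definition side C (i : nat) : set (R * R) :=
  segment C`_i C`_(i.+1 %% size C).

Definition convex_hull Q : set (R * R) :=
  [set v | exists w : nat -> R,
     [/\ forall i, 0 <= w i,
         \sum_(i < size Q) w i = 1,
         v.1 = \sum_(i < size Q) w i * (Q`_i).1
       & v.2 = \sum_(i < size Q) w i * (Q`_i).2]].

Definition area Q : \bar R :=
  ((@lebesgue_measure R) \x (@lebesgue_measure R))%E (convex_hull Q).

(* Q is not required to lie inside C. *)
Definition inscribed Q C : Prop :=
  convex_polygon Q /\
  forall i : nat, (i < size C)%N -> exists2 v, v \in Q & side C i v.

Definition min_inscribed_area C : \bar R :=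
  ereal_inf [set area Q | Q in [set Q | inscribed Q C]].

Definition min_area_inscribed Q C : Prop :=
  inscribed Q C /\ area Q = min_inscribed_area C.

End ConvexPolygons.

(* The machine model: structured programs for a real RAM, with index registers
   n_0, n_1, ... holding natural numbers, real registers x_0, x_1, ... and real
   arrays A_0, A_1, ... of unbounded length. Index registers only serve for
   addressing and loop control; there is no conversion between reals and
   indices. The only constants a program may contain are natural numbers and
   integers, so that a program is a finite object independent of the reals. *)

Inductive real_op := AddR | SubR | MulR | DivR.

Inductive test :=
| LeI of nat & nat              (* n_i <= n_j *)
| LeR of nat & nat.             (* x_k <= x_l *)

Inductive program :=
| Skip
| Seq of program & program
| ConstI of nat & nat           (* n_i := k *)
| AddI of nat & nat & nat       (* n_i := n_j + n_k *)
| SubI of nat & nat & nat       (* n_i := n_j - n_k, truncated at 0 *)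
| ConstR of nat & int           (* x_k := z *)
| OpR of real_op & nat & nat & nat (* x_k := x_l op x_m *)
| ReadA of nat & nat & nat       (* x_k := A_a[n_i] *)
| WriteA of nat & nat & nat      (* A_a[n_i] := x_k *)
| If of test & program & program
| While of test & program.

Definition upd (T : Type) (f : nat -> T) (i : nat) (v : T) : nat -> T :=
  fun j => if j == i then v else f j.

Section Semantics.
Variable R : realType.

Record state := State {
  idx : nat -> nat;
  reg : nat -> R;
  arr : nat -> nat -> R }.

Implicit Types s : state.

Definition set_idx s i n := State (upd (idx s) i n) (reg s) (arr s).
Definition set_reg s k x := State (idx s) (upd (reg s) k x) (arr s).
Definition set_arr s a i x :=
  State (idx s) (reg s) (upd (arr s) a (upd (arr s a) i x)).

(* Division by zero yields 0. *)
Definition eval_op (o : real_op) (x y : R) : R :=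
  match o with
  | AddR => x + y
  | SubR => x - y
  | MulR => x * y
  | DivR => x / y
  end.

Definition eval_test (b : test) s : bool :=
  match b with
  | LeI i j => (idx s i <= idx s j)%N
  | LeR k l => reg s k <= reg s l
  end.

(* exec p s t s': started in s, the program p halts in s' after t steps. Every
   assignment, memory access and evaluated test is one step, including those
   that only involve indices. *)
Inductive exec : program -> state -> nat -> state -> Prop :=
| exec_skip s : exec Skip s 0 s
| exec_seq p q s1 t1 s2 t2 s3 :
    exec p s1 t1 s2 -> exec q s2 t2 s3 -> exec (Seq p q) s1 (t1 + t2) s3
| exec_constI i k s : exec (ConstI i k) s 1 (set_idx s i k)
| exec_addI i j k s :
    exec (AddI i j k) s 1 (set_idx s i (idx s j + idx s k)%N)
| exec_subI i j k s :
    exec (SubI i j k) s 1 (set_idx s i (idx s j - idx s k)%N)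
| exec_constR k z s : exec (ConstR k z) s 1 (set_reg s k z%:~R)
| exec_opR o k l m s :
    exec (OpR o k l m) s 1 (set_reg s k (eval_op o (reg s l) (reg s m)))
| exec_readA k a i s : exec (ReadA k a i) s 1 (set_reg s k (arr s a (idx s i)))
| exec_writeA a i k s : exec (WriteA a i k) s 1 (set_arr s a (idx s i) (reg s k))
| exec_if b p q s t s' :
    exec (if eval_test b s then p else q) s t s' -> exec (If b p q) s t.+1 s'
| exec_while_false b p s : ~~ eval_test b s -> exec (While b p) s 1 s
| exec_while_true b p s1 t1 s2 t2 s3 :
    eval_test b s1 -> exec p s1 t1 s2 -> exec (While b p) s2 t2 s3 ->
    exec (While b p) s1 (t1 + t2).+1 s3.

Lemma exec_deterministic p s t1 s1 t2 s2 :
  exec p s t1 s1 -> exec p s t2 s2 -> t1 = t2 /\ s1 = s2.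
Proof.
move=> e1; elim: e1 t2 s2 => {p s t1 s1}.
- by move=> s t2 s2 e; inversion e.
- move=> p q s1 t1 s2 t2 s3 _ IH1 _ IH2 t s e; inversion e; subst.
  match goal with H : exec p _ _ _ |- _ => case: (IH1 _ _ H) => ? ? end; subst.
  by match goal with H : exec q _ _ _ |- _ => case: (IH2 _ _ H) => -> -> end.
- by move=> i k s t2 s2 e; inversion e.
- by move=> i j k s t2 s2 e; inversion e.
- by move=> i j k s t2 s2 e; inversion e.
- by move=> k z s t2 s2 e; inversion e.
- by move=> o k l m s t2 s2 e; inversion e.
- by move=> k a i s t2 s2 e; inversion e.
- by move=> a i k s t2 s2 e; inversion e.
- move=> b p q s t s' _ IH t2 s2 e; inversion e; subst.
  by match goal with H : exec _ _ _ _ |- _ => case: (IH _ _ H) => -> -> end.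
- move=> b p s Nb t2 s2 e; inversion e; subst => //.
  by match goal with H : is_true (eval_test b s) |- _ => rewrite H in Nb end.
- move=> b p s1 t1 s2 t2 s3 hb _ IH1 _ IH2 t s e; inversion e; subst.
    by match goal with H : is_true (~~ _) |- _ => rewrite hb in H end.
  match goal with H : exec p _ _ _ |- _ => case: (IH1 _ _ H) => ? ? end; subst.
  by match goal with H : exec (While _ _) _ _ _ |- _ =>
    case: (IH2 _ _ H) => -> -> end.
Qed.

(* Input and output format: n_0 is the number of vertices, and A_0, A_1 list
   their first and second coordinates. All other memory is unconstrained, so
   a program may not assume that it is initialised. *)
Definition encodes (s : state) (P : seq (R * R)) : Prop :=
  idx s 0%N = size P /\
  forall i : nat, (i < size P)%N ->
    arr s 0%N i = (P`_i).1 /\ arr s 1%N i = (P`_i).2.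

End Semantics.

(* Main.v *)
(** The area of a polygon inscribed in [C] is at least that of the hull of one
    point [(1 - t_i) p_i + t_i p_(i+1)] on each side of [C]. This hull and the
    corners cut off at the vertices cover [C], and the corner at [p_i] has area
    [(1 - t_(i-1)) t_i] times that of the triangle [p_(i-1) p_i p_(i+1)]. The
    total cut-off area is multi-affine in [t], so it is largest when every [t_i]
    is 0 or 1, that is, when the points are vertices of [C] and the removed
    vertices are pairwise non-adjacent; conversely, the triangles at pairwise
    non-adjacent vertices are disjoint. A minimum area inscribed polygon is thus
    obtained by removing an independent set of maximum weight in a weighted
    cycle. As two adjacent vertices are not both removed, vertex 0 or vertex 1
    is kept, which leaves two instances of the problem on a path, solved by
    dynamic programming in linear time. *)

Require Import Defs.
From mathcomp Require Import all_boot all_order all_algebra.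
From mathcomp Require Import all_classical all_reals all_analysis.
From mathcomp Require Import measurable_realfun.
From mathcomp Require Import zify ring lra.

Set Implicit Arguments.
Unset Strict Implicit.
Unset Printing Implicit Defensive.

Import Order.TTheory GRing.Theory Num.Theory.
Import numFieldNormedType.Exports.

Local Open Scope classical_set_scope.
Local Open Scope ring_scope.

(** * Area of a triangle *)

Section TriangleArea.
Variable R : realType.
Implicit Types (a b c v : R * R) (S : set (R * R)).

Notation mu := (@lebesgue_measure R).
Notation mu2 := ((@lebesgue_measure R) \x (@lebesgue_measure R))%E.

Lemma integral_affine (p q a b : R) : a <= b ->
  (\int[mu]_(x in `[a, b]) (p + q * x)%:E =
   ((b - a) * ((p + q * a) + (p + q * b)) / 2)%:E)%E.
Proof.
rewrite le_eqVlt => /predU1P[->|ab].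
  by rewrite set_itv1 integral_set1 subrr !mul0r.
pose F x : R := p * x + q / 2 * x ^+ 2.
have dF (x : R) : is_derive x (1 : R) F (p + q * x).
  rewrite /F; apply: is_derive_eq.
  by rewrite /GRing.scale/=; field.
have cF (x : R) : {for x, continuous F}.
  by apply: differentiable_continuous; apply/derivable1_diffP; have [] := dF x.
rewrite (@continuous_FTC2 _ _ F) //.
- by rewrite /F -EFinB; congr EFin; field.
- apply: continuous_subspaceT => x; apply: cvgD; first exact: cvg_cst.
  by apply: cvgM; [exact: cvg_cst|exact: cvg_id].
- split.
  + by move=> x _; have [] := dF x.
  + exact/cvg_at_right_filter/cF.
  + exact/cvg_at_left_filter/cF.
- by move=> x _; rewrite derive1E; have [] := dF x.
Qed.

(** Over the open interval, each vertical section of [S] lies between an open and a closed interval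
    with the same ends. Its length is therefore determined, whichever boundary points [S]
    contains. *)
Lemma area_slab S (al be l0 l1 u0 u1 : R) :
  measurable S -> al <= be ->
  (forall x y, S (x, y) -> al <= x <= be) ->
  (forall x, al < x < be -> l0 + l1 * x <= u0 + u1 * x) ->
  (forall x y, al < x < be -> S (x, y) ->
     l0 + l1 * x <= y <= u0 + u1 * x) ->
  (forall x y, al < x < be -> l0 + l1 * x < y < u0 + u1 * x ->
     S (x, y)) ->
  mu2 S = ((be - al) * ((u0 + u1 * al - (l0 + l1 * al)) +
                        (u0 + u1 * be - (l0 + l1 * be))) / 2)%:E.
Proof.
move=> mS abe Sab lu Slu luS.
rewrite /product_measure1.
have mf : measurable_fun [set: R] (fun x : R => mu (xsection S x)).
  exact: measurable_fun_xsection.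
have -> : (\int[mu]_x (mu \o xsection S) x =
           \int[mu]_(x in `[al, be]) (mu \o xsection S) x)%E.
  rewrite [RHS]integral_mkcond; apply: eq_integral => x _.
  rewrite patchE; case: ifPn => //; rewrite notin_setE/= => xab.
  rewrite (_ : xsection S x = set0) ?measure0//.
  apply/seteqP; split => // y /xsectionP/Sab H; apply: xab.
  by rewrite in_itv.
have -> : (\int[mu]_(x in `[al, be]) (mu \o xsection S) x =
   \int[mu]_(x in `[al, be]) (((u0 - l0) + (u1 - l1) * x)%:E))%E.
  rewrite integral_itv_bndoo; last first.
    exact: measurable_funTS.
  rewrite [RHS]integral_itv_bndoo; last first.
    apply/measurable_funTS/measurable_EFinP.
    by apply: measurable_funD => //; apply: measurable_funM.
  apply: eq_integral => x; rewrite inE/= in_itv/= => xab.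
  have mx : measurable (xsection S x) by exact: measurable_xsection.
  have -> : u0 - l0 + (u1 - l1) * x = u0 + u1 * x - (l0 + l1 * x) by ring.
  set u := u0 + _; set l := l0 + _.
  have lu' : l <= u by exact: lu.
  have E (b1 b2 : bool) :
      mu [set` Interval (BSide b1 l) (BSide b2 u)] = (u - l)%:E.
    rewrite lebesgue_measure_itv/= lte_fin; case: ifPn => //.
    by rewrite -leNgt => ul; congr EFin; lra.
  apply/eqP; rewrite eq_le; apply/andP; split.
    rewrite -(E true false); apply: le_measure; rewrite ?inE//.
    by move=> y /xsectionP/(Slu _ _ xab); rewrite /= in_itv.
  rewrite -(E false true); apply: le_measure; rewrite ?inE//.
  by move=> y; rewrite /= in_itv/= => /(luS _ _ xab) ?; apply/xsectionP.
rewrite integral_affine//; congr EFin; ring.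
Qed.


(* With [s = -1] the graph of [u0 + u1 * x] is the lower boundary. *)
Lemma area_slab_sign (s : bool) S (al be l0 l1 u0 u1 : R) :
  measurable S -> al <= be ->
  (forall x y, S (x, y) -> al <= x <= be) ->
  (forall x, al < x < be ->
     0 <= (-1) ^+ s * (u0 + u1 * x - (l0 + l1 * x))) ->
  (forall x y, al < x < be -> S (x, y) ->
     0 <= (-1) ^+ s * (y - (l0 + l1 * x)) /\
     0 <= (-1) ^+ s * (u0 + u1 * x - y)) ->
  (forall x y, al < x < be -> 0 < (-1) ^+ s * (y - (l0 + l1 * x)) ->
     0 < (-1) ^+ s * (u0 + u1 * x - y) -> S (x, y)) ->
  mu2 S = ((be - al) * ((-1) ^+ s * ((u0 + u1 * al - (l0 + l1 * al)) +
                        (u0 + u1 * be - (l0 + l1 * be)))) / 2)%:E.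
Proof.
case: s => mS abe Sab lu Slu luS; rewrite ?expr1 ?expr0 in lu Slu luS *.
- rewrite (@area_slab S al be u0 u1 l0 l1)//.
  + by congr EFin; ring.
  + by move=> x /lu; lra.
  + by move=> x y h /(Slu _ _ h)[]; lra.
  + by move=> x y h ?; apply: luS => //; lra.
- rewrite (@area_slab S al be l0 l1 u0 u1)//.
  + by congr EFin; ring.
  + by move=> x /lu; lra.
  + by move=> x y h /(Slu _ _ h)[]; lra.
  + by move=> x y h ?; apply: luS => //; lra.
Qed.

Definition slope a b : R := (b.2 - a.2) / (b.1 - a.1).
Definition intercept a b : R := a.2 - a.1 * slope a b.

Lemma orient_line a b x y : a.1 < b.1 ->
  orient a b (x, y) = (b.1 - a.1) * (y - (intercept a b + slope a b * x)).
Proof.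
move=> ab; have nz : b.1 - a.1 != 0 by rewrite subr_eq0 gt_eqF.
by rewrite /orient /intercept /slope /=; field.
Qed.

Lemma slope_left a b : intercept a b + slope a b * a.1 = a.2.
Proof. by rewrite /intercept; ring. Qed.

Lemma slope_right a b : a.1 < b.1 -> intercept a b + slope a b * b.1 = b.2.
Proof.
move=> ab; have nz : b.1 - a.1 != 0 by rewrite subr_eq0 gt_eqF.
by rewrite /intercept /slope; field.
Qed.

Lemma orient_sum a b c v :
  orient a b v + orient b c v + orient c a v = orient a b c.
Proof. by rewrite /orient; ring. Qed.

(** First coordinate of the identity that makes the three areas unnormalised barycentric coordinates
    of [v]. *)
Lemma orient_barycenter a b c v :
  orient b c v * (v.1 - a.1) + orient c a v * (v.1 - b.1)
  + orient a b v * (v.1 - c.1) = 0.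
Proof. by rewrite /orient; ring. Qed.

Lemma orientC a b v : orient b a v = - orient a b v.
Proof. by rewrite /orient; ring. Qed.

(** The vertical line through the middle vertex [b] splits the triangle into two slabs, each bounded
    by an edge at [b] and by the long edge [ac]. The sign [s] tells whether [b] lies below or above
    [ac]. *)
Lemma area_triangle_sorted (s : bool) a b c S :
  measurable S -> a.1 <= b.1 -> b.1 <= c.1 -> 0 < (-1) ^+ s * orient a b c ->
  (forall v, S v -> [/\ 0 <= (-1) ^+ s * orient a b v,
     0 <= (-1) ^+ s * orient b c v & 0 <= (-1) ^+ s * orient c a v]) ->
  (forall v, 0 < (-1) ^+ s * orient a b v -> 0 < (-1) ^+ s * orient b c v ->
     0 < (-1) ^+ s * orient c a v -> S v) ->
  mu2 S = ((-1) ^+ s * orient a b c / 2)%:E.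
Proof.
move=> mS ab bc abc SP PS.
have ac : a.1 < c.1.
  rewrite lt_neqAle (le_trans ab bc) andbT; apply: contraTN abc => /eqP ac.
  have -> : orient a b c = 0.
    have ba : b.1 = a.1 by apply/eqP; rewrite eq_le ab ac bc.
    by rewrite /orient ba -ac; ring.
  by rewrite mulr0 ltxx.
set e := (-1) ^+ s in abc SP PS *.
have bary v : e * orient b c v * (v.1 - a.1) + e * orient c a v * (v.1 - b.1)
  + e * orient a b v * (v.1 - c.1) = 0.
  by rewrite -!mulrA -!mulrDr orient_barycenter mulr0.
have tot v : e * orient a b v + e * orient b c v + e * orient c a v =
    e * orient a b c.
  by rewrite -!mulrDr orient_sum.
have lineE p q x y : p.1 < q.1 -> e * orient p q (x, y) =
    (q.1 - p.1) * (e * (y - (intercept p q + slope p q * x))).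
  by move=> /orient_line ->; ring.
have lineE' p q x y : p.1 < q.1 -> e * orient q p (x, y) =
    (q.1 - p.1) * (e * (intercept p q + slope p q * x - y)).
  by move=> /orient_line; rewrite orientC => ->; ring.
pose A : set (R * R) := [set v | v.1 <= b.1].
have mA : measurable A.
  have -> : A = setT `&` fst @^-1` `]-oo, b.1].
    by rewrite setTI; apply/seteqP; split => v; rewrite /A /= in_itv.
  exact: measurable_fst.
have -> : mu2 S = (mu2 (S `\` A) + mu2 (S `&` A))%E by exact: measureDI.
have x_ge x y : S (x, y) -> a.1 <= x.
  (* For a point to the left of all three vertices, no term of [bary] is positive, although the
     weights have positive sum. *)
  move=> /SP[h1 h2 h3]; rewrite leNgt; apply/negP => xa.
  have := bary (x, y); have := tot (x, y) => /=.
  nra.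
have x_le x y : S (x, y) -> x <= c.1.
  move=> /SP[h1 h2 h3]; rewrite leNgt; apply/negP => xa.
  have := bary (x, y); have := tot (x, y) => /=.
  nra.
have sl p q x y : p.1 < q.1 -> 0 <= e * orient p q (x, y) ->
    0 <= e * (y - (intercept p q + slope p q * x)).
  by move=> pq; rewrite lineE// pmulr_rge0// subr_gt0.
have su p q x y : p.1 < q.1 -> 0 <= e * orient q p (x, y) ->
    0 <= e * (intercept p q + slope p q * x - y).
  by move=> pq; rewrite lineE'// pmulr_rge0// subr_gt0.
have sl' p q x y : p.1 < q.1 -> 0 < e * (y - (intercept p q + slope p q * x)) ->
    0 < e * orient p q (x, y).
  by move=> pq; rewrite lineE// => ?; rewrite mulr_gt0// subr_gt0.
have su' p q x y : p.1 < q.1 -> 0 < e * (intercept p q + slope p q * x - y) ->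
    0 < e * orient q p (x, y).
  by move=> pq; rewrite lineE'// => ?; rewrite mulr_gt0// subr_gt0.
have on x : e * orient c a (x, intercept a c + slope a c * x) = 0.
  by rewrite lineE'//; ring.
rewrite (@area_slab_sign s (S `&` A) a.1 b.1 (intercept a b) (slope a b)
  (intercept a c) (slope a c))//; first last.
- move=> x y /andP[ax xb] /sl' h1 /(su' a c _ _ ac) h2.
  have {}h1 := h1 (lt_trans ax xb); split; last exact: ltW.
  (* Left of [b] the two known weights have negative coefficients in [bary], which forces the third
     weight to be positive. *)
  apply: PS => //; have /= := bary (x, y); nra.
- move=> x y /andP[ax xb] [/SP[h1 _ h3] _]; split.
    exact/sl/h1/(lt_trans ax xb).
  exact: su.
- move=> x /andP[ax xb]; apply: sl; first exact: (lt_trans ax xb).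
  have /= := bary (x, intercept a c + slope a c * x).
  have /= := tot (x, intercept a c + slope a c * x).
  rewrite on; nra.
- by move=> x y [/x_ge -> /=].
- exact: measurableI.
rewrite (@area_slab_sign s (S `\` A) b.1 c.1 (intercept b c) (slope b c)
  (intercept a c) (slope a c))//; first last.
- move=> x y /andP[bx xc] /sl' h1 /(su' a c _ _ ac) h2.
  have {}h1 := h1 (lt_trans bx xc); split; last by apply/negP; rewrite -ltNge.
  apply: PS => //; have /= := bary (x, y); nra.
- move=> x y /andP[bx xc] [/SP[_ h2 h3] _]; split.
    exact/sl/h2/(lt_trans bx xc).
  exact: su.
- move=> x /andP[bx xc]; apply: sl; first exact: (lt_trans bx xc).
  have /= := bary (x, intercept a c + slope a c * x).
  have /= := tot (x, intercept a c + slope a c * x).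
  rewrite on; nra.
- by move=> x y [/x_le -> /negP]; rewrite /A/= -ltNge => /ltW ->.
- exact: measurableD.
rewrite -EFinD !slope_left (slope_right ac); congr EFin.
have -> : orient a b c =
    (c.1 - a.1) * (intercept a c + slope a c * b.1 - b.2).
  have := orient_line b.1 b.2 ac; rewrite -surjective_pairing orientC => h.
  by rewrite -(orient_sum _ _ _ b); move: h; rewrite /orient => h; lra.
(* The factor [b.1 - a.1] keeps the identity true for a vertical edge, whose slope is the default
   value 0. *)
have h1 : (b.1 - a.1) * (intercept a b + slope a b * b.1) = (b.1 - a.1) * b.2.
  move: ab; rewrite le_eqVlt => /predU1P[->|?]; first by rewrite subrr !mul0r.
  by rewrite slope_right.
have h2 : (c.1 - b.1) * (intercept b c + slope b c * c.1) = (c.1 - b.1) * c.2.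
  move: bc; rewrite le_eqVlt => /predU1P[->|?]; first by rewrite subrr !mul0r.
  by rewrite slope_right.
apply/eqP; rewrite -subr_eq0; apply/eqP.
rewrite -/e; set L := intercept a c + _.
transitivity (e / 2 * ((c.1 - b.1) * c.2
   - (c.1 - b.1) * (intercept b c + slope b c * c.1) + (b.1 - a.1) * b.2
   - (b.1 - a.1) * (intercept a b + slope a b * b.1))); first by field.
by rewrite h1 h2; ring.
Qed.

(** A rotation brings a leftmost vertex to the front. If [c] is then left of [b], exchanging them
    gives a clockwise triangle, which the sign takes care of. *)
Lemma area_triangle a b c S :
  measurable S -> 0 < orient a b c ->
  (forall v, S v ->
     [/\ 0 <= orient a b v, 0 <= orient b c v & 0 <= orient c a v]) ->
  (forall v, 0 < orient a b v -> 0 < orient b c v -> 0 < orient c a v -> S v) ->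
  mu2 S = (orient a b c / 2)%:E.
Proof.
move=> mS; wlog /andP[ab ac] : a b c / (a.1 <= b.1) && (a.1 <= c.1).
  move=> H abc SP PS.
  have bca : orient b c a = orient a b c by rewrite /orient; ring.
  have cab : orient c a b = orient a b c by rewrite /orient; ring.
  have [bmin|bmin] := boolP ((b.1 <= c.1) && (b.1 <= a.1)).
    rewrite -bca; apply: H; rewrite ?bca//; first by move=> v /SP[].
    by move=> v ? ? ?; exact: PS.
  have [cmin|cmin] := boolP ((c.1 <= a.1) && (c.1 <= b.1)).
    rewrite -cab; apply: H; rewrite ?cab//; first by move=> v /SP[].
    by move=> v ? ? ?; exact: PS.
  apply: H => //; move: bmin cmin; rewrite !negb_and -!ltNge.
  by move=> /orP[?|?] /orP[?|?]; apply/andP; split; lra.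
move=> abc SP PS; have [bc|/ltW cb] := leP b.1 c.1.
  have := @area_triangle_sorted false a b c S mS ab bc.
  rewrite expr0 !mul1r => -> //.
  + by move=> v /SP[]; rewrite !mul1r.
  + by move=> v; rewrite !mul1r; exact: PS.
have neg p q r : (-1) ^+ true * orient p q r = orient q p r.
  by rewrite expr1 /orient; ring.
have := @area_triangle_sorted true a c b S mS ac cb.
have acb : orient c a b = orient a b c by rewrite /orient; ring.
rewrite !neg acb => -> //.
- by move=> v /SP[]; rewrite !neg.
- by move=> v; rewrite !neg => ? ? ?; exact: PS.
Qed.

End TriangleArea.

(** * Convex hulls and corners *)

Section Hulls.
Variable R : realType.
Implicit Types (a b c p q v x y : R * R) (A C Q : seq (R * R)).

Definition mix (w : R) x y : R * R :=
  (w * x.1 + (1 - w) * y.1, w * x.2 + (1 - w) * y.2).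

Lemma mix1 x y : mix 1 x y = x.
Proof. by case: x => x1 x2; congr pair => /=; ring. Qed.

Lemma mix0 x y : mix 0 x y = y.
Proof. by case: y => y1 y2; congr pair => /=; ring. Qed.

Lemma orient_mix a b w x y :
  orient a b (mix w x y) = w * orient a b x + (1 - w) * orient a b y.
Proof. by rewrite /orient /=; ring. Qed.

Lemma segmentP a b v :
  segment a b v <-> exists2 t : R, 0 <= t <= 1 & v = mix (1 - t) a b.
Proof.
split=> [[t [t0 t1 v1 v2]]|[t /andP[t0 t1] ->]].
  exists t; first by rewrite t0.
  by rewrite (surjective_pairing v) v1 v2; congr pair; ring.
by exists t; split=> //=; ring.
Qed.

Lemma convex_hull_mem Q q : q \in Q -> convex_hull Q q.
Proof.
move=> qQ; exists (fun i => (i == index q Q)%:R).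
have lt : (index q Q < size Q)%N by rewrite index_mem.
have E (f : nat -> R) : \sum_(i < size Q) (i == index q Q :> nat)%:R * f i
    = f (index q Q).
  rewrite (bigD1 (Ordinal lt))//= eqxx mul1r big1 ?addr0// => i.
  by rewrite -val_eqE/= => /negPf ->; rewrite mul0r.
split.
- by move=> i; rewrite ler0n.
- by rewrite -[RHS](E (fun=> 1)); apply: eq_bigr => i _; rewrite mulr1.
- by rewrite (E (fun i => (Q`_i).1)) nth_index.
- by rewrite (E (fun i => (Q`_i).2)) nth_index.
Qed.

Lemma convex_hull_comb3 Q x y z v (r s t : R) :
  convex_hull Q x -> convex_hull Q y -> convex_hull Q z ->
  0 <= r -> 0 <= s -> 0 <= t -> r + s + t = 1 ->
  v.1 = r * x.1 + s * y.1 + t * z.1 ->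
  v.2 = r * x.2 + s * y.2 + t * z.2 ->
  convex_hull Q v.
Proof.
move=> [wx [wx0 wx1 x1 x2]] [wy [wy0 wy1 y1 y2]] [wz [wz0 wz1 z1 z2]].
move=> r0 s0 t0 rst v1 v2.
exists (fun i => r * wx i + s * wy i + t * wz i).
have E (f : nat -> R) :
    \sum_(i < size Q) (r * wx i + s * wy i + t * wz i) * f i =
    r * (\sum_(i < size Q) wx i * f i) + s * (\sum_(i < size Q) wy i * f i)
    + t * (\sum_(i < size Q) wz i * f i).
  by rewrite !mulr_sumr -!big_split/=; apply: eq_bigr => i _; ring.
split.
- by move=> i; rewrite !addr_ge0// mulr_ge0.
- have /(_ (fun=> 1)) := E; under eq_bigr do rewrite mulr1.
  move=> ->; under eq_bigr do rewrite mulr1.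
  rewrite wx1; under eq_bigr do rewrite mulr1.
  rewrite wy1; under eq_bigr do rewrite mulr1.
  by rewrite wz1 !mulr1.
- by rewrite v1 (E (fun i => (Q`_i).1)) -x1 -y1 -z1.
- by rewrite v2 (E (fun i => (Q`_i).2)) -x2 -y2 -z2.
Qed.

Lemma convex_hull_mix Q w x y : 0 <= w <= 1 ->
  convex_hull Q x -> convex_hull Q y -> convex_hull Q (mix w x y).
Proof.
move=> /andP[w0 w1] Qx Qy.
apply: (@convex_hull_comb3 Q x y y _ w (1 - w) 0) => //=; last 3 first.
- by ring.
- by ring.
- by ring.
by rewrite subr_ge0.
Qed.

Lemma convex_hull_nil v : ~ convex_hull [::] v.
Proof.
by move=> [w [_ + _ _]]; rewrite big_ord0 => /eqP; rewrite eq_sym oner_eq0.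
Qed.

Lemma convex_hull_cons p A v : convex_hull (p :: A) v ->
  v = p \/ exists w y, [/\ 0 <= w <= 1, convex_hull A y & v = mix w p y].
Proof.
move=> [w [w0]]; rewrite !big_ord_recl/= /bump/= => w1 v1 v2.
have w01 : 0 <= w 0%N <= 1.
  by rewrite w0 -w1 lerDl sumr_ge0// => i _; exact: w0.
have [w0E|w0N] := eqVneq (w 0%N) 1.
  left; have S0 : \sum_(i < size A) w (1 + i)%N = 0 by rewrite w0E in w1; lra.
  have wi0 (i : 'I_(size A)) : w (1 + i)%N = 0.
    by move/psumr_eq0P: S0 => ->//= j _; exact: w0.
  rewrite (surjective_pairing v) v1 v2 w0E !big1 ?mul1r ?addr0.
  - exact/esym/surjective_pairing.
  - by move=> i _; rewrite wi0 mul0r.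
  - by move=> i _; rewrite wi0 mul0r.
right; pose u := 1 - w 0%N.
have u0 : 0 < u by rewrite subr_gt0 lt_neqAle w0N; case/andP: w01.
have E (f : nat -> R) : \sum_(i < size A) w (1 + i)%N / u * f i =
    (\sum_(i < size A) w (1 + i)%N * f i) / u.
  by rewrite mulr_suml; apply: eq_bigr => i _; ring.
exists (w 0%N), ((v.1 - w 0%N * p.1) / u, (v.2 - w 0%N * p.2) / u); split=> //.
- exists (fun i => w (1 + i)%N / u); split=> //.
  + by move=> i; rewrite divr_ge0 ?w0// ltW.
  + rewrite -mulr_suml (_ : \sum_(i < size A) _ = u) ?divff ?gt_eqF//.
    by rewrite /u -w1; ring.
  + by rewrite (E (fun i => (A`_i).1)) v1 [w 0%N * _ + _]addrC addrK.
  + by rewrite (E (fun i => (A`_i).2)) v2 [w 0%N * _ + _]addrC addrK.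
- rewrite (surjective_pairing v) /mix/= -/u; congr pair; field;
    exact: lt0r_neq0.
Qed.

Lemma convex_hull_ind A (K : set (R * R)) :
  (forall q, q \in A -> K q) ->
  (forall w x y, 0 <= w <= 1 -> K x -> K y -> K (mix w x y)) ->
  convex_hull A `<=` K.
Proof.
move=> + Kmix; elim: A => [|p A IH] AK v; first by move/convex_hull_nil.
move=> /convex_hull_cons[->|[w [y [w01 Ay ->]]]].
  by apply: AK; rewrite mem_head.
apply: Kmix => //; first by apply: AK; rewrite mem_head.
by apply: IH Ay => q qA; apply: AK; rewrite in_cons qA orbT.
Qed.

Lemma convex_hull_subset A Q :
  {subset A <= Q} -> convex_hull A `<=` convex_hull Q.
Proof.
move=> AQ; apply: convex_hull_ind => [q /AQ/convex_hull_mem//|w x y].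
exact: convex_hull_mix.
Qed.

Lemma convex_hull_halfplane A a b :
  (forall q, q \in A -> 0 <= orient a b q) ->
  convex_hull A `<=` [set v | 0 <= orient a b v].
Proof.
move=> Aab; apply: convex_hull_ind => // w x y /andP[w0 w1] /= x0 y0.
by rewrite orient_mix addr_ge0// mulr_ge0// subr_ge0.
Qed.

Lemma convex_hull_triangle Q a b c v :
  convex_hull Q a -> convex_hull Q b -> convex_hull Q c ->
  0 < orient a b c -> 0 <= orient a b v -> 0 <= orient b c v ->
  0 <= orient c a v -> convex_hull Q v.
Proof.
move=> Qa Qb Qc abc ab bc ca.
have nz := lt0r_neq0 abc.
apply: (@convex_hull_comb3 Q a b c _ (orient b c v / orient a b c)
  (orient c a v / orient a b c) (orient a b v / orient a b c)) => //;
  try by rewrite divr_ge0// ltW.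
all: by move: nz; rewrite /orient => nz; field.
Qed.

(* Write [v] as a mixture of [p] and a point [y] of the hull of [A]. If [y] is
   not strictly on the inner side of [ab], this forces [v = y]; otherwise [p]
   can be eliminated in favour of [a], [b] and [y]. *)
Lemma convex_hull_cut A a p b v :
  a \in A -> b \in A -> 0 < orient a p b ->
  (forall q, q \in A -> 0 <= orient a p q) ->
  (forall q, q \in A -> 0 <= orient p b q) ->
  convex_hull (p :: A) v -> 0 <= orient a b v -> convex_hull A v.
Proof.
move=> aA bA apb Aap Apb.
move=> /convex_hull_cons[->|[w [y [/andP[w0 w1] Ay ->]]]].
  have -> : orient a b p = - orient a p b by rewrite /orient; ring.
  by rewrite oppr_ge0 leNgt apb.
rewrite orient_mix (_ : orient a b p = - orient a p b); last first.
  by rewrite /orient; ring.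
set D := orient a p b in apb *; set f := orient a b y => v0.
have [f0|f0] := lerP f 0.
  have wE : w = 0 by apply/eqP; rewrite eq_le w0 andbT leNgt; apply/negP; nra.
  by rewrite wE mix0.
have Ha := convex_hull_mem aA; have Hb := convex_hull_mem bA.
have hy1 : 0 <= orient a p y by exact: (convex_hull_halfplane Aap).
have hy2 : 0 <= orient p b y by exact: (convex_hull_halfplane Apb).
(* The weights come from eliminating [p] by [f * p = orient p b y * a + orient a p y * b - D * y];
   the last one is nonnegative by [v0]. *)
apply: (@convex_hull_comb3 A a b y _ (w * orient p b y / f)
  (w * orient a p y / f) ((1 - w) - w * D / f)) => //.
- by rewrite divr_ge0 ?mulr_ge0// ltW.
- by rewrite divr_ge0 ?mulr_ge0// ltW.
- by rewrite subr_ge0 ler_pdivrMr//; lra.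
- move: (lt0r_neq0 f0); rewrite /f /D /orient => nz; field; exact: nz.
- move: (lt0r_neq0 f0); rewrite /f /D /orient /= => nz; field; exact: nz.
- move: (lt0r_neq0 f0); rewrite /f /D /orient /= => nz; field; exact: nz.
Qed.

End Hulls.

(** * Cyclic indexing of the vertices, half-planes and corners *)

Section CyclicVertices.
Variables (R : realType) (C : seq (R * R)).
Hypothesis convC : convex_polygon C.
Implicit Types (i j k d : nat) (v a b : R * R).

Notation mu2 := ((@lebesgue_measure R) \x (@lebesgue_measure R))%E.
Local Notation n := (size C).

Definition vtx i : R * R := C`_(i %% n)%N.
(* Twice the area of the triangle cut off by removing the vertex [i + 1]. *)
Definition ear i : R := orient (vtx i) (vtx i.+1) (vtx i.+2).

Let n_gt0 : (0 < n)%N. Proof. by case: convC => /(leq_trans _)->. Qed.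

Lemma vtxDn i : vtx (i + n) = vtx i.
Proof. by rewrite /vtx modnDr. Qed.

Lemma vtx_small i : (i < n)%N -> vtx i = C`_i.
Proof. by move=> lt; rewrite /vtx modn_small. Qed.

Lemma vtx_mem i : vtx i \in C.
Proof. by rewrite mem_nth ?ltn_pmod. Qed.

Lemma mem_vtx v : v \in C -> exists2 i, (i < n)%N & v = vtx i.
Proof.
move=> vC; have lt : (index v C < n)%N by rewrite index_mem.
by exists (index v C) => //; rewrite vtx_small// nth_index.
Qed.

Lemma sideE i : side C i = segment C`_i (vtx i.+1).
Proof. by []. Qed.

(** Measuring [j] from [i] turns cyclic positions into an offset below [n], on which case analysis
    is possible. *)
Lemma vtx_shift i j :
  exists d, [/\ (d < n)%N, vtx j = vtx (i + d) & (j %% n = (i + d) %% n)%N].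
Proof.
exists ((j + (n - i %% n)) %% n)%N.
have E : (j %% n = (i + (j + (n - i %% n)) %% n) %% n)%N.
  rewrite modnDmr addnCA -modnDmr -[in RHS](modnDml i) subnKC.
    by rewrite modnn addn0.
  by rewrite ltnW ?ltn_pmod.
by split; rewrite ?ltn_pmod// /vtx {1}E.
Qed.

(** The three indices lie within one period, so reduction modulo [n] only permutes them cyclically,
    and [orient] is invariant under such permutations. *)
Lemma orient_vtx i j k : (i < j)%N -> (j < k)%N -> (k < i + n)%N ->
  0 < orient (vtx i) (vtx j) (vtx k).
Proof.
case: convC => _ convP.
wlog ltin : i j k / (i < n)%N => [H ij jk ki|].
  have [in'|ni] := ltnP i n; first exact: H.
  have sub l : (i <= l)%N -> vtx l = vtx (l - i %/ n * n)%N.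
    move=> il; rewrite -[in LHS](@subnK (i %/ n * n) l).
      by rewrite /vtx addnC modnMDl.
    by rewrite (leq_trans (leq_divM _ _)).
  have ik := ltn_trans ij jk.
  have := leq_divM i n.
  have := ltn_pmod i n_gt0; have := divn_eq i n.
  rewrite (sub i)// (sub j) ?(ltnW ij)// (sub k) ?(ltnW ik)// => e1 e2 e3.
  by apply: H; lia.
move=> ij jk ki.
have sub l : (n <= l)%N -> vtx l = vtx (l - n).
  by move=> /subnK {1}<-; rewrite vtxDn.
have [kn|nk] := ltnP k n.
  by rewrite !vtx_small; [exact: convP|lia|lia|lia].
have rot p q r : orient (R := R) p q r = orient r p q.
  by rewrite /orient; ring.
rewrite (sub k)// rot; have [jn|nj] := ltnP j n.
  by rewrite !vtx_small; [apply: convP; lia|lia|lia|lia].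
by rewrite (sub j)// rot !vtx_small; [apply: convP; lia|lia|lia|lia].
Qed.

Lemma ear_gt0 i : 0 < ear i.
Proof. by have [n3 _] := convC; apply: orient_vtx => //; lia. Qed.

Lemma orient_same13 a v : orient a v a = 0.
Proof. by rewrite /orient; ring. Qed.

Lemma orient_same23 a v : orient a v v = 0.
Proof. by rewrite /orient; ring. Qed.

Lemma orient_edge_vtx i j : 0 <= orient (vtx i) (vtx i.+1) (vtx j).
Proof.
have [d [dn -> _]] := vtx_shift i j.
case: d dn => [|[|d]] dn; first by rewrite addn0 orient_same13.
  by rewrite addn1 orient_same23.
by apply/ltW/orient_vtx; lia.
Qed.

Lemma orient_ear_vtx i j : (j %% n != i.+1 %% n)%N ->
  0 <= orient (vtx i) (vtx i.+2) (vtx j).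
Proof.
have [d [dn -> ->]] := vtx_shift i j.
case: d dn => [|[|[|d]]] dn; first by rewrite addn0 orient_same13.
- by rewrite addn1 eqxx.
- by rewrite addn2 orient_same23.
- by move=> _; apply/ltW/orient_vtx; lia.
Qed.

Lemma orient_edge i v : convex_hull C v -> 0 <= orient (vtx i) (vtx i.+1) v.
Proof.
apply: convex_hull_halfplane => q /mem_vtx[j _ ->]; exact: orient_edge_vtx.
Qed.

(* Conversely, a point in all half-planes lies in a triangle of the fan from
   the first vertex. *)
Lemma convex_hullP v : convex_hull C v <->
  (forall i, (i < n)%N -> 0 <= orient (vtx i) (vtx i.+1) v).
Proof.
split=> [Cv i _|H]; first exact: orient_edge.
have [n3 _] := convC.
pose f k := orient (vtx 0) (vtx k) v.
have f1 : 0 <= f 1%N by exact: H.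
(* The least such [m] gives the fan triangle [0], [m.-1], [m] containing [v]. The index [n.-1]
   qualifies because the last side ends at vertex 0. *)
have exm : exists m, (2 <= m < n)%N && (f m <= 0).
  exists n.-1; apply/andP; split; first lia.
  rewrite /f orientC oppr_le0; have := H n.-1.
  rewrite prednK// => /(_ (leqnn _)).
  by rewrite -[vtx n]/(vtx (0 + n)) vtxDn.
have [m /andP[/andP[m2 mn] fm] minm] := ex_minnP exm.
have fm1 : 0 <= f m.-1.
  have [->|m3] := eqVneq m 2; first exact: f1.
  rewrite leNgt; apply/negP => /ltW f0.
  have := minm m.-1; rewrite f0 andbT => /(_ _)/implyP; lia.
have mC i : convex_hull C (vtx i) by exact/convex_hull_mem/vtx_mem.
apply: (@convex_hull_triangle R C (vtx 0) (vtx m.-1) (vtx m)) => //.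
- by apply: orient_vtx; lia.
- by have := H m.-1; rewrite prednK; [apply; lia|lia].
- by rewrite orientC oppr_ge0.
Qed.

Lemma measurable_halfplane a b : measurable [set v | 0 <= orient a b v].
Proof.
have mf : measurable_fun [set: R * R] (orient a b).
  by apply: measurable_funB; apply: measurable_funM => //;
    apply: measurable_funB.
have -> : [set v | 0 <= orient a b v] = setT `&` orient a b @^-1` `[0, +oo[.
  by rewrite setTI; apply/seteqP; split=> v /=; rewrite in_itv/= andbT.
by apply: mf => //; exact: measurable_itv.
Qed.

Lemma measurable_convex_hull : measurable (convex_hull C).
Proof.
have -> : convex_hull C = \bigcap_(i in `I_n)
    [set v | 0 <= orient (vtx i) (vtx i.+1) v].
  by apply/seteqP; split=> v /convex_hullP.
by apply: bigcap_measurable => [|i _]; [exists 0|exact: measurable_halfplane].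
Qed.


Definition corner a b : set (R * R) :=
  [set v | convex_hull C v /\ ~ 0 <= orient a b v].

Lemma measurable_corner a b : measurable (corner a b).
Proof.
apply: measurableI; first exact: measurable_convex_hull.
exact: (measurableC (measurable_halfplane a b)).
Qed.

Lemma orient_mix_edge i w v : 0 <= w <= 1 -> convex_hull C v ->
  0 <= orient (mix w (vtx i) (vtx i.+1)) (vtx i.+1) v.
Proof.
move=> /andP[w0 w1] Cv.
have -> : orient (mix w (vtx i) (vtx i.+1)) (vtx i.+1) v =
    w * orient (vtx i) (vtx i.+1) v by rewrite /orient/=; ring.
by apply: mulr_ge0 => //; exact: orient_edge.
Qed.

Lemma orient_edge_mix i w v : 0 <= w <= 1 -> convex_hull C v ->
  0 <= orient (vtx i) (mix w (vtx i) (vtx i.+1)) v.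
Proof.
move=> /andP[w0 w1] Cv.
have -> : orient (vtx i) (mix w (vtx i) (vtx i.+1)) v =
    (1 - w) * orient (vtx i) (vtx i.+1) v by rewrite /orient/=; ring.
by apply: mulr_ge0; [rewrite subr_ge0|exact: orient_edge].
Qed.

Lemma orient_chord i s t :
  orient (mix (1 - s) (vtx i) (vtx i.+1)) (vtx i.+1)
    (mix (1 - t) (vtx i.+1) (vtx i.+2)) = (1 - s) * t * ear i.
Proof. by rewrite /ear /orient /=; ring. Qed.

Lemma convex_hull_side i w : 0 <= w <= 1 ->
  convex_hull C (mix w (vtx i) (vtx i.+1)).
Proof.
by move=> w01; apply: convex_hull_mix => //; exact/convex_hull_mem/vtx_mem.
Qed.

Lemma subr01 (t : R) : 0 <= t <= 1 -> 0 <= 1 - t <= 1.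
Proof. by move=> /andP[? ?]; apply/andP; split; lra. Qed.

(* A chord between two adjacent sides is degenerate when one of its endpoints
   is their common vertex. *)
Lemma orient_chord0 i s t v : 0 <= s <= 1 -> 0 <= t <= 1 ->
  (1 - s) * t = 0 -> convex_hull C v ->
  0 <= orient (mix (1 - s) (vtx i) (vtx i.+1))
    (mix (1 - t) (vtx i.+1) (vtx i.+2)) v.
Proof.
move=> s01 t01 /eqP; rewrite mulf_eq0 => /orP[/eqP ->|/eqP ->] Cv.
  by rewrite mix0; apply: orient_edge_mix => //; exact: subr01.
by rewrite subr0 mix1; apply: orient_mix_edge => //; exact: subr01.
Qed.

(** The corner is the triangle spanned by the chord and the vertex [i.+1], without the chord itself;
    a degenerate chord cuts off nothing. *)
Lemma area_corner i s t : 0 <= s <= 1 -> 0 <= t <= 1 ->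
  mu2 (corner (mix (1 - s) (vtx i) (vtx i.+1))
              (mix (1 - t) (vtx i.+1) (vtx i.+2))) =
  ((1 - s) * t * ear i / 2)%:E.
Proof.
move=> s01 t01; have e0 := ear_gt0 i.
have st0 : 0 <= (1 - s) * t.
  by case/andP: s01 => _ ?; case/andP: t01 => ? _; rewrite mulr_ge0 ?subr_ge0.
move: st0; rewrite le_eqVlt => /predU1P[st0|st0].
  rewrite -st0 !mul0r (_ : corner _ _ = set0) ?measure0//.
  by apply/seteqP; split=> // v [Cv]; apply; apply: orient_chord0.
have := orient_chord i s t; set a := mix _ _ _; set b := mix _ _ _ => abE.
rewrite -abE; have ab0 : 0 < orient a (vtx i.+1) b by rewrite abE mulr_gt0.
have cab v : orient b a v = - orient a b v by exact: orientC.
apply: area_triangle => //; first exact: measurable_corner.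
  move=> v [Cv /negP]; rewrite -ltNge => ab; split.
  - by apply: orient_mix_edge => //; exact: subr01.
  - by apply: orient_edge_mix => //; exact: subr01.
  - by rewrite cab oppr_ge0 ltW.
move=> v apv pbv bav; split; last by apply/negP; rewrite -ltNge -oppr_gt0 -cab.
apply: (@convex_hull_triangle _ _ a (vtx i.+1) b) => //; try exact: ltW.
- exact/convex_hull_side/subr01.
- exact/convex_hull_mem/vtx_mem.
- exact/convex_hull_side/subr01.
Qed.

End CyclicVertices.

(** * Covering by corners and packing of ears *)

Section CutCorners.
Variables (R : realType) (C : seq (R * R)).
Hypothesis convC : convex_polygon C.
Implicit Types (i j k d : nat) (v a b : R * R) (Q : seq (R * R)).

Notation mu2 := ((@lebesgue_measure R) \x (@lebesgue_measure R))%E.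
Local Notation n := (size C).

Section Inscribed.
Variables (t : nat -> R) (Q : seq (R * R)).
Hypothesis t01 : forall i, 0 <= t i <= 1.
Hypothesis tn : t n = t 0%N.
Let pt i := mix (1 - t i) (vtx C i) (vtx C i.+1).
Hypothesis Qpt : forall i, (i < n)%N -> convex_hull Q (pt i).

Let ptn : pt n = pt 0%N.
Proof.
by rewrite /pt tn; congr mix; [exact: (vtxDn C 0)|exact: (vtxDn C 1)].
Qed.

(** The vertices of [C] are first adjoined to the chosen points and then dropped one by one;
    [convex_hull_cut] keeps [v] in the hull each time. *)
Lemma convex_hull_cover v : convex_hull C v ->
  (forall i, (i < n)%N -> 0 <= orient (pt i) (pt i.+1) v) -> convex_hull Q v.
Proof.
move=> Cv ptv; pose V := mkseq pt n.
have ptV i : (i < n)%N -> pt i \in V.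
  by move=> lt; apply/mapP; exists i; rewrite // mem_iota.
have CV q : q \in V -> convex_hull C q.
  by move=> /mapP[i _ ->]; apply: convex_hull_side => //; exact: subr01.
suff : convex_hull V v.
  by apply: convex_hull_ind => [q /mapP[i + ->]|w x y];
    [rewrite mem_iota => /Qpt|exact: convex_hull_mix].
(* The list of vertices is shifted because chord [k] cuts off the vertex [k.+1]. *)
have : convex_hull ([seq vtx C i.+1 | i <- iota 0 n] ++ V) v.
  move: Cv; apply: convex_hull_subset => q /mem_vtx[i lt ->].
  rewrite mem_cat; apply/orP; left; apply/mapP.
  case: i lt => [|i] lt; last by exists i => //; rewrite mem_iota; lia.
  exists n.-1; first by rewrite mem_iota; lia.
  by rewrite prednK//; exact/esym/(vtxDn C 0).
have : all (fun i => i < n)%N (iota 0 n).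
  by apply/allP => i; rewrite mem_iota.
elim: (iota 0 n) => //= k s IH /andP[kn sn] Hv; apply: IH => //.
set A := _ ++ V in Hv *.
have CA q : q \in A -> convex_hull C q.
  rewrite mem_cat => /orP[/mapP[i _ ->]|/CV//].
  exact/convex_hull_mem/vtx_mem.
have VA q : q \in V -> q \in A by rewrite mem_cat orbC => ->.
have aA : pt k \in A by exact/VA/ptV.
have bA : pt k.+1 \in A.
  apply: VA; move: kn; rewrite leq_eqVlt => /predU1P[->|/ptV//].
  by rewrite ptn; apply: ptV; case: convC => /(leq_trans _)->.
have e0 := ear_gt0 convC k.
have [/andP[_ tk] /andP[tk' _]] := (t01 k, t01 k.+1).
have pA : vtx C k.+1 \in A -> convex_hull A v.
  move=> pA; move: Hv; apply: convex_hull_subset => q.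
  by rewrite in_cons => /predU1P[->|].
(* In the two degenerate cases the vertex [k.+1] is itself a chosen point, so dropping its extra
   copy changes nothing. *)
have [tk1|tk1] := eqVneq (t k) 1.
  by apply: pA; rewrite /pt tk1 subrr mix0 in aA.
have [tk0|tk0] := eqVneq (t k.+1) 0.
  by apply: pA; rewrite /pt tk0 subr0 mix1 in bA.
apply: (convex_hull_cut aA _ _ _ _ Hv (ptv _ kn)) => //.
- rewrite /pt orient_chord mulr_gt0 ?mulr_gt0// ?subr_gt0 ?lt_neqAle ?tk1//.
  by rewrite eq_sym tk0.
- by move=> q /CA; apply: orient_mix_edge => //; exact: subr01.
- by move=> q /CA; apply: orient_edge_mix => //; exact: subr01.
Qed.

Lemma area_le_add_corners : measurable (convex_hull Q) ->
  (mu2 (convex_hull C) <= mu2 (convex_hull Q) +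
     ((\sum_(i < n) (1 - t i) * t i.+1 * ear C i) / 2)%:E)%E.
Proof.
move=> mQ; pose K i := corner C (pt i) (pt i.+1).
have mK i : measurable (K i) by exact: measurable_corner.
have mU : measurable (\big[setU/set0]_(i < n) K i).
  by apply: bigsetU_measurable => i _; exact: mK.
apply: (@le_trans _ _ (mu2 (convex_hull Q `|` \big[setU/set0]_(i < n) K i))).
  apply: le_measure; rewrite ?inE//.
  - exact: measurable_convex_hull.
  - exact: measurableU.
  move=> v Cv.
  have [H|] := pselect
      (forall i, (i < n)%N -> 0 <= orient (pt i) (pt i.+1) v).
    by left; exact: convex_hull_cover.
  move=> /existsNP[i /not_implyP[lt H]]; right.
  by rewrite -bigcup_mkord; exists i.
set U := \big[setU/set0]_(i < n) K i in mU *.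
have U2 : (mu2 (convex_hull Q `|` U) <= mu2 (convex_hull Q) + mu2 U)%E.
  exact: measureU2.
have UK : (mu2 U <= \sum_(i < n) mu2 (K i))%E.
  by apply: Boole_inequality => i _; exact: mK.
apply: (le_trans U2); apply: leeD2l; apply: (le_trans UK).
rewrite mulr_suml -sumEFin; apply: lee_sum => i _.
by rewrite area_corner.
Qed.

End Inscribed.

(** Imposing the half-planes of the chords one after another removes a complete ear each time, since
    every ear lies within the half-planes of the other chords. The hull of [Q] survives all cuts. *)
Lemma area_add_ears Q (s : seq nat) :
  measurable (convex_hull Q) -> {subset Q <= C} -> uniq s ->
  (forall i q, i \in s -> q \in Q -> 0 <= orient (vtx C i) (vtx C i.+2) q) ->
  (forall i j k, i \in s -> j \in s -> i != j -> (k < 3)%N ->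
     0 <= orient (vtx C i) (vtx C i.+2) (vtx C (j + k))) ->
  (mu2 (convex_hull Q) + ((\sum_(i <- s) ear C i) / 2)%:E <=
     mu2 (convex_hull C))%E.
Proof.
move=> mQ QC us sQ ss.
pose K (r : seq nat) := [set v | convex_hull C v /\
  forall i, i \in r -> 0 <= orient (vtx C i) (vtx C i.+2) v].
have mK r : measurable (K r).
  have -> : K r = convex_hull C `&` \bigcap_(i in [set i | i \in r])
      [set v | 0 <= orient (vtx C i) (vtx C i.+2) v] by [].
  apply: measurableI; first exact: measurable_convex_hull.
  apply: bigcap_measurableType => i _.
  exact: measurable_halfplane.
suff H (r : seq nat) : {subset r <= s} -> uniq r ->
    (mu2 (K r) + ((\sum_(i <- r) ear C i) / 2)%:E = mu2 (convex_hull C))%E.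
  rewrite -(H s)//; apply: leeD2r.
  apply: le_measure; rewrite ?inE//; first exact: mK.
  move=> v Qv; rewrite /K/=; split=> [|i si]; first exact: convex_hull_subset Qv.
  by apply: (convex_hull_halfplane _ Qv) => q; exact: sQ.
elim: r => [|i r IH] rs ur.
  rewrite big_nil mul0r adde0; congr product_measure1.
  by rewrite /K; apply/seteqP; split=> [v /= []|v Cv].
case/andP: ur => ir ur.
have rs' : {subset r <= s} by move=> j jr; apply: rs; rewrite in_cons jr orbT.
rewrite big_cons mulrDl EFinD addeA -(IH rs' ur); congr (_ + _)%E.
pose H := [set v | 0 <= orient (vtx C i) (vtx C i.+2) v].
have mH : measurable H by exact: measurable_halfplane.
have -> : mu2 (K r) = (mu2 (K r `\` H) + mu2 (K r `&` H))%E.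
  by apply: measureDI => //; exact: mK.
rewrite addeC; congr (_ + _)%E.
  (* For the parameters 0 and 1 the chord joins both neighbours of the vertex [i.+1], so the corner
     is the whole ear. *)
  have := @area_corner _ _ convC i 0 1; rewrite subr0 subrr mix1 mix0 !mul1r.
  move=> <-; rewrite ?lexx ?ler01//; congr product_measure1.
  apply/seteqP; split=> v; last by move=> [[Cv _] Hv].
  move=> [Cv Hv]; rewrite /K/=; split=> //; split=> // j jr.
  have iv : ~~ (0 <= orient (vtx C i) (vtx C i.+2) v) by exact/negP.
  have ji : j != i by apply: contraNneq ir => <-.
  have : convex_hull [:: vtx C i; vtx C i.+1; vtx C i.+2] v.
    apply: (@convex_hull_triangle _ _ (vtx C i) (vtx C i.+1) (vtx C i.+2)).
    - by apply: convex_hull_mem; rewrite !inE eqxx.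
    - by apply: convex_hull_mem; rewrite !inE eqxx orbT.
    - by apply: convex_hull_mem; rewrite !inE eqxx !orbT.
    - exact: ear_gt0.
    - exact: orient_edge.
    - exact: orient_edge.
    - by rewrite orientC oppr_ge0 ltW// ltNge.
  apply: (@convex_hull_halfplane _ _ (vtx C j) (vtx C j.+2)) => q.
  have si : i \in s by rewrite rs// mem_head.
  have sj := rs' _ jr.
  rewrite !inE => /or3P[] /eqP ->; 
    [rewrite -(addn0 i)|rewrite -(addn1 i)|rewrite -(addn2 i)];
    by apply: ss.
congr product_measure1; apply/seteqP; split=> v.
  move=> [Cv Hv]; split; last by apply: Hv; rewrite mem_head.
  by split=> // j jr; apply: Hv; rewrite in_cons jr orbT.
move=> [[Cv Kv] Hv]; split=> // j.
by rewrite in_cons => /predU1P[->//|]; exact: Kv.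
Qed.

End CutCorners.

(** * Maximum weight independent sets *)

Section PathIndependentSet.
Variables (R : realType) (w : nat -> R) (L : nat).
Implicit Types (i j m o n : nat).

(** The pair holds the optima for the last [m] and the last [m - 1] vertices, which makes the
    two-step recurrence structural. *)
Fixpoint best_tail m : R * R :=
  if m is m'.+1 then
    let p := best_tail m' in (Num.max p.1 (w (L - m) + p.2), p.1)
  else (0, 0).

(* Maximum weight of an independent set of the path on the vertices
   [i, ..., L - 1]. *)
Definition best i : R := (best_tail (L - i)).1.

Lemma best_ge i : (L <= i)%N -> best i = 0.
Proof. by rewrite /best -subn_eq0 => /eqP ->. Qed.

Lemma best_rec i : (i < L)%N -> best i = Num.max (best i.+1) (w i + best i.+2).
Proof.
move=> iL; have E : (L - i = (L - i.+1).+1)%N by lia.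
rewrite /best E /= -E subKn ?(ltnW iL)//.
congr (Num.max _ (_ + _)); case E' : (L - i.+1)%N => [|m] /=.
  by have -> : (L - i.+2 = 0)%N by lia.
by have -> : (L - i.+2 = m)%N by lia.
Qed.

Lemma best_decr i : best i.+1 <= best i.
Proof.
have [Li|iL] := leqP L i; first by rewrite !best_ge// ltnW.
by rewrite (best_rec iL) le_max lexx.
Qed.

Lemma best_add i : (i < L)%N -> w i + best i.+2 <= best i.
Proof. by move=> iL; rewrite (best_rec iL) le_max lexx orbT. Qed.

(** The right side interpolates between the optimum with [i] available and the optimum with [i]
    blocked. This form, affine in the parameter of the predecessor, is stable under adding a vertex
    at the front of the path. *)
Lemma fractional_le_best (t : nat -> R) i :
  (forall j, 0 <= t j <= 1) -> (0 < i)%N -> (i <= L)%N ->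
  \sum_(i <= j < L) (1 - t j.-1) * t j * w j <=
    (1 - t i.-1) * best i + t i.-1 * best i.+1.
Proof.
move=> t01 + iL; move Em : (L - i)%N => m.
elim: m i Em iL => [|m IH] i Em iL i0.
  by rewrite big_geq ?best_ge ?mulr0 ?addr0//; lia.
have iL' : (i < L)%N by lia.
rewrite big_ltn//; have := IH i.+1; rewrite /= => /(_ _ iL' isT).
have -> : (L - i.+1)%N = m by lia.
move=> /(_ erefl); set S := \sum_(_ <= _ < _) _ => hS.
have h1 := best_decr i; have h2 := best_decr i.+1; have h3 := best_add iL'.
have /andP[a0 a1] := t01 i.-1; have /andP[b0 b1] := t01 i.
apply: (le_trans (lerD (lexx _) hS)).
(* [H1] and [H2] treat the extreme values 0 and 1 of [t i.-1], weighted so that they add up to the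
   goal. *)
have H1 : (1 - t i.-1) * (t i * (w i + best i.+2) + (1 - t i) * best i.+1) <=
    (1 - t i.-1) * best i.
  by apply: ler_wpM2l; [lra|nra].
have H2 : t i.-1 * ((1 - t i) * best i.+1 + t i * best i.+2) <=
    t i.-1 * best i.+1.
  by apply: ler_wpM2l; [lra|nra].
lra.
Qed.

End PathIndependentSet.

(** * Reading an optimal independent set off the table *)

Section GreedyExclusion.
Variables (R : realType) (D : nat -> R) (o : nat).
Implicit Types (i j m : nat).

(* [skip m.+1] says that the vertex [o + m] is excluded; the initial value
   forces [o] to be kept. *)
Fixpoint skip m : bool :=
  if m is m'.+1 then ~~ skip m' && (D (o + m').+1 < D (o + m')%N) else true.

Definition kept n : seq nat := [seq m <- iota 0 n | ~~ skip m.+1].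
(** An entry [m] stands for the excluded vertex [o + m + 1], whose ear has index [o + m]; hence the
    shift against [kept]. *)
Definition skipped n : seq nat := [seq m <- iota 0 n | skip m.+2].

Lemma skipS m : skip m.+1 = ~~ skip m && (D (o + m).+1 < D (o + m)%N).
Proof. by []. Qed.

Lemma skip1 : skip 1 = false. Proof. by []. Qed.

Lemma skip_succ m : skip m -> skip m.+1 = false.
Proof. by rewrite skipS => ->. Qed.

End GreedyExclusion.

Arguments skip : simpl never.
Arguments kept : simpl never.

Lemma sum_skipped (R : realType) (w : nat -> R) o n : (0 < n)%N ->
  \sum_(m <- skipped (best w (o + n)) o n.-1) w (o + m).+1 =
  best w (o + n) o.+1.
Proof.
move=> n0; set D := best w (o + n).
(* Invariant: the weight collected so far plus the optimum of the remaining path is the total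
   optimum. After an excluded vertex that path starts one vertex later. *)
suff H k : (k < n)%N -> \sum_(m <- skipped D o k) w (o + m).+1 +
    (if skip D o k.+1 then D (o + k).+2 else D (o + k).+1) = D o.+1.
  have := H n.-1; rewrite prednK// => /(_ (leqnn _)) <-.
  have -> : (o + n.-1).+1 = (o + n)%N by lia.
  by rewrite /D !best_ge// if_same addr0.
elim: k => [|k IH] kn; first by rewrite /skipped/= big_nil add0r addn0.
rewrite -(IH (ltnW kn)) /skipped -addn1 iotaD filter_cat big_cat/= -addrA.
congr (_ + _); rewrite add0n addn1.
have kL : ((o + k).+1 < o + n)%N by lia.
have := @best_rec _ w _ _ kL; rewrite -/D => Dk.
rewrite (skipS _ _ k.+1) !addnS; case: (skip D o k.+1) => /=.
  by rewrite big_nil add0r.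
case: ltP => h; rewrite ?big_nil ?big_seq1 ?add0r.
  move: Dk; rewrite maxEle; case: ifP => // _ e; by rewrite e ltxx in h.
by apply/eqP; rewrite eq_le h andbT; apply: best_decr.
Qed.

(** * The minimum area inscribed polygon *)

Section OptimalPolygon.
Variables (R : realType) (C : seq (R * R)).
Hypothesis convC : convex_polygon C.
Implicit Types (i j k m o : nat) (D : nat -> R) (v : R * R).

Notation mu2 := ((@lebesgue_measure R) \x (@lebesgue_measure R))%E.
Local Notation n := (size C).

(** The shift is due to [ear] being indexed by the vertex before the removed one. The paths
    considered use indices from 1 on, with [n] standing for vertex 0. *)
Definition weight j : R := ear C j.-1.
(* Twice the largest area that can be cut off while the vertex [o] is kept. *)
Definition value o : R := best weight (o + n) o.+1.
Definition kept_polygon D o : seq (R * R) :=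
  [seq vtx C (o + m)%N | m <- kept D o n].

Let n_gt0 : (0 < n)%N. Proof. by case: convC => /(leq_trans _)->. Qed.

(* The sum is affine in [t 0]: at [t 0 = 0] it is a sum over the path starting
   after the vertex 0, and at [t 0 = 1] over the path starting after 1. *)
Lemma sum_corners_le (t : nat -> R) :
  (forall i, 0 <= t i <= 1) -> t n = t 0%N ->
  \sum_(i < n) (1 - t i) * t i.+1 * ear C i <= Num.max (value 0) (value 1).
Proof.
move=> t01 tn; have [n3 _] := convC.
pose F j := (1 - t j.-1) * t j * weight j.
have -> : \sum_(i < n) (1 - t i) * t i.+1 * ear C i = \sum_(1 <= j < n.+1) F j.
  by rewrite big_add1/= big_mkord.
rewrite big_nat_recr// big_ltn ?(leq_trans _ n3)//=.
set mid := \sum_(_ <= _ < _) _.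
(* With value 0 there, the term of vertex [n] would vanish, leaving the path from 1 to [n - 1]. *)
pose t0 i := if i == 0%N then 0 else t i.
have t001 i : 0 <= t0 i <= 1.
  by rewrite /t0; case: eqP => // _; rewrite lexx ler01.
have := @fractional_le_best _ weight n t0 1 t001 isT n_gt0.
rewrite big_ltn ?(leq_trans _ n3)//= (_ : \sum_(_ <= _ < _) _ = mid);
  last first.
  by apply: eq_big_nat => -[|[|j]].
rewrite {1 3 4}/t0/= subr0 !mul1r mul0r addr0 -/(value 0) => h0.
(* With value 1 at [n], hence at 0, the term of vertex 1 would vanish, leaving the path from 2 to
   [n]. *)
pose t1 i := if i == n then 1 else t i.
have t101 i : 0 <= t1 i <= 1.
  by rewrite /t1; case: eqP => // _; rewrite lexx ler01.
have := @fractional_le_best _ weight n.+1 t1 2 t101 isT (leqW (ltnW n3)).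
rewrite big_nat_recr ?(leq_trans _ n3)//= (_ : \sum_(_ <= _ < _) _ = mid);
  last first.
  apply: eq_big_nat => j /andP[_ jn]; rewrite /t1 !ifF//; last lia.
  by apply/negP; lia.
rewrite {1 2}/t1 eqxx ifF; last by apply/negP; lia.
rewrite mulr1 => h1'.
have h1 : mid + (1 - t n.-1) * weight n <= value 1.
  apply: (le_trans h1').
  have := best_decr weight n.+1 2; have /andP := t101 1%N.
  rewrite /value add1n; nra.
have /andP[a0 a1] := t01 0%N.
have : (1 - t 0%N) * (t 1%N * weight 1 + mid) <= (1 - t 0%N) * value 0.
  by apply: ler_wpM2l; rewrite ?subr_ge0.
have : t 0%N * (mid + (1 - t n.-1) * weight n) <= t 0%N * value 1.
  exact: ler_wpM2l.
have : (1 - t 0%N) * value 0 <= (1 - t 0%N) * Num.max (value 0) (value 1).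
  by apply: ler_wpM2l; rewrite ?subr_ge0// le_max lexx.
have : t 0%N * value 1 <= t 0%N * Num.max (value 0) (value 1).
  by apply: ler_wpM2l; rewrite // le_max lexx orbT.
rewrite /F/= tn; lra.
Qed.

Lemma area_inscribed_ge (Q : seq (R * R)) : inscribed Q C ->
  (mu2 (convex_hull C) <=
   area Q + (Num.max (value 0) (value 1) / 2)%:E)%E.
Proof.
move=> [convQ sidesQ].
have /choice[t tP] i : exists t, 0 <= t <= 1 /\
    mix (1 - t) (vtx C i) (vtx C i.+1) \in Q.
  have [v vQ] := sidesQ (i %% n)%N (ltn_pmod _ n_gt0).
  rewrite sideE => /segmentP[t t01 vE]; exists t; split=> //.
  by move: vE vQ; rewrite /vtx -addn1 modnDml addn1 => ->.
pose t' i := t (i %% n)%N.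
have t'01 i : 0 <= t' i <= 1 by have [] := tP (i %% n)%N.
have t'n : t' n = t' 0%N by rewrite /t' modnn mod0n.
have Qt i : (i < n)%N ->
    convex_hull Q (mix (1 - t' i) (vtx C i) (vtx C i.+1)).
  move=> lt; apply: convex_hull_mem; rewrite /t' modn_small//.
  by have [] := tP i.
have mQ := measurable_convex_hull convQ.
apply: (le_trans (area_le_add_corners convC t'01 t'n Qt mQ)).
apply: leeD2l; rewrite lee_fin ler_pM2r//; exact: sum_corners_le.
Qed.

Lemma mem_kept D o m : m \in kept D o n = ~~ skip D o m.+1 && (m < n)%N.
Proof. by rewrite mem_filter mem_iota. Qed.

(** Consecutive vertices are never both excluded; across the seam, the successor of the last vertex
    is [o], which is kept. *)
Lemma kept_polygon_side D o i : exists2 v, v \in kept_polygon D o &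
  v = vtx C i \/ v = vtx C i.+1.
Proof.
have vtxK m : (m < n)%N -> ~~ skip D o m.+1 ->
    vtx C (o + m) \in kept_polygon D o.
  by move=> mn ms; apply/mapP; exists m => //; rewrite mem_kept ms.
have [m [mn vE mE]] := vtx_shift convC o i.
have vE' : vtx C i.+1 = vtx C (o + m).+1.
  by rewrite /vtx -addn1 -modnDml mE modnDml addn1.
have [sm|sm] := boolP (skip D o m.+1); last first.
  by exists (vtx C i); [rewrite vE vtxK|left].
exists (vtx C i.+1); last by right.
rewrite vE' -addnS; move: (mn); rewrite leq_eqVlt => /predU1P[->|mn'].
  by rewrite vtxDn; have := vtxK 0%N n_gt0 isT; rewrite addn0.
by rewrite vtxK// skip_succ.
Qed.

Lemma kept_polygon_inscribed D o : (5 <= n)%N -> inscribed (kept_polygon D o) C.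
Proof.
move=> n5; split; last first.
  move=> i lt; have [v vK vE] := kept_polygon_side D o i.
  exists v => //; rewrite sideE; apply/segmentP; rewrite -(vtx_small lt).
  case: vE => ->.
    by exists 0; rewrite ?lexx ?ler01// subr0 mix1.
  by exists 1; rewrite ?lexx ?ler01// subrr mix0.
split.
  rewrite size_map size_filter -(subnKC n5) iotaD count_cat.
  (* Three kept vertices are already found among the offsets 0 to 4: 0 is kept, and at most two of 1
     to 4 are excluded. *)
  apply: leq_trans (leq_addr _ _) => /=.
  rewrite (skipS _ _ 4) (skipS _ _ 3) (skipS _ _ 2) (skipS _ _ 1) skip1.
  by do 4?case: (_ < _).
move=> i j k ij jk; rewrite size_map => kK.
have jK := ltn_trans jk kK; have iK := ltn_trans ij jK.
rewrite /kept_polygon !(nth_map 0%N)//.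
have srt : sorted ltn (kept D o n).
  by apply: sorted_filter (iota_ltn_sorted _ _); exact: ltn_trans.
have lt a b : (a < b)%N -> (b < size (kept D o n))%N ->
    (nth 0 (kept D o n) a < nth 0 (kept D o n) b)%N.
  move=> ab bK; apply: (sorted_ltn_nth ltn_trans 0%N srt) => //.
  exact: ltn_trans bK.
apply: orient_vtx => //; rewrite ?ltn_add2l ?lt//.
have := mem_nth 0%N kK; rewrite mem_kept => /andP[_ kn].
by rewrite -addnA ltn_add2l (leq_trans kn) ?leq_addl.
Qed.

(** Excluded vertices are pairwise non-adjacent, so no corner of one ear, and no kept vertex, lies
    beyond the chord of another ear. *)
Lemma area_kept_polygon_le o :
  (5 <= n)%N ->
  (area (kept_polygon (best weight (o + n)) o) + (value o / 2)%:E <=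
   mu2 (convex_hull C))%E.
Proof.
move=> n5; set D := best weight (o + n); have [convK _] := kept_polygon_inscribed D o n5.
have vE : value o = \sum_(i <- [seq (o + m)%N | m <- skipped D o n.-1]) ear C i.
  by rewrite /value -(sum_skipped weight o n_gt0) big_map.
have mods x y : (x < n)%N -> (y < n)%N -> x != y ->
    ((o + x) %% n != (o + y) %% n)%N.
  by move=> xn yn; rewrite eqn_modDl !modn_small.
have mem_sk m : m \in skipped D o n.-1 = skip D o m.+2 && (m < n.-1)%N.
  by rewrite mem_filter mem_iota.
rewrite vE; apply: area_add_ears => //.
- exact: measurable_convex_hull.
- by move=> q /mapP[m _ ->]; exact: vtx_mem.
- by rewrite map_inj_uniq ?filter_uniq ?iota_uniq//; exact: addnI.
- move=> i q /mapP[m + ->] /mapP[l + ->]; rewrite mem_kept mem_sk.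
  move=> /andP[sm mn] /andP[sl ln]; apply: orient_ear_vtx => //.
  rewrite -addnS; apply: mods => //; first lia.
  by apply: contraNneq sl => ->.
- move=> i j k /mapP[m + ->] /mapP[l + ->]; rewrite !mem_sk.
  move=> /andP[sm mn] /andP[sl ln] ml k3.
  have {}ml : l != m by apply: contraNneq ml => ->.
  apply: orient_ear_vtx => //; rewrite -addnS -addnA.
  have s1 : l != m.+1.
    by apply/eqP => lm; move: sl; rewrite lm skip_succ.
  have s2 : m != l.+1.
    by apply/eqP => lm; move: sm; rewrite lm skip_succ.
  have [lk|lk] := ltnP (l + k) n; first by apply: mods => //; lia.
  (* Since [l <= n - 2] and [k <= 2], the offset can only reach [n] exactly, that is, return to
     [o]. *)
  have -> : (l + k = n)%N by lia.
  rewrite modnDr -[X in (X %% _)%N != _]addn0; apply: mods => //; lia.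
Qed.

Lemma kept_polygon_min o : (5 <= n)%N -> (o < 2)%N ->
  value o = Num.max (value 0) (value 1) ->
  min_area_inscribed (kept_polygon (best weight (o + n)) o) C.
Proof.
move=> n5 o2 vo; set K := kept_polygon _ _.
have KC : inscribed K C by exact: kept_polygon_inscribed.
split=> //; apply/eqP; rewrite eq_le; apply/andP; split; last first.
  by apply: ereal_inf_lbound; exists K.
apply: le_ereal_inf_tmp => _ [Q QC <-].
(* Both bounds involve the same finite term [value o / 2], which cancels. *)
have := le_trans (area_kept_polygon_le o n5) (area_inscribed_ge QC).
by rewrite -vo leeD2rE.
Qed.

End OptimalPolygon.

(** * The algorithm *)

Section LoopFreePrograms.
Variable R : realType.
Implicit Types (p q : program) (s : state R).

Fixpoint loop_free p : bool :=
  match p with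
  | Seq p q => loop_free p && loop_free q
  | If _ p q => loop_free p && loop_free q
  | While _ _ => false
  | _ => true
  end.

(* Register numbers are compared with [eqn], which reduces on numerals. *)
Definition updn T (f : nat -> T) i (v : T) : nat -> T :=
  fun j => if eqn j i then v else f j.

(** Evaluates straight-line code by reduction. Array cells keep [upd], as their addresses are
    symbolic; the [While] case is a dummy ruled out by [loop_free]. *)
Fixpoint run p s : state R :=
  match p with
  | Skip => s
  | Seq p q => run q (run p s)
  | ConstI i k => State (updn (idx s) i k) (reg s) (arr s)
  | AddI i j k => State (updn (idx s) i (idx s j + idx s k)%N) (reg s) (arr s)
  | SubI i j k => State (updn (idx s) i (idx s j - idx s k)%N) (reg s) (arr s)
  | ConstR k z => State (idx s) (updn (reg s) k z%:~R) (arr s)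
  | OpR o k l m =>
      State (idx s) (updn (reg s) k (eval_op o (reg s l) (reg s m))) (arr s)
  | ReadA k a i => State (idx s) (updn (reg s) k (arr s a (idx s i))) (arr s)
  | WriteA a i k =>
      State (idx s) (reg s) (updn (arr s) a (upd (arr s a) (idx s i) (reg s k)))
  | If b p q => if eval_test b s then run p s else run q s
  | While _ _ => s
  end.

Fixpoint cost p : nat :=
  match p with
  | Skip => 0
  | Seq p q => cost p + cost q
  | If _ p q => (maxn (cost p) (cost q)).+1
  | _ => 1
  end.

Definition halts_within p s c s' := exists2 t, exec p s t s' & (t <= c)%N.

Lemma halts_run p s : loop_free p -> halts_within p s (cost p) (run p s).
Proof.
elim: p s => //=; try by move=> *; exists 1%N => //; constructor.
- by move=> s _; exists 0%N => //; constructor.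
- move=> p IHp q IHq s /andP[/IHp Hp /IHq Hq].
  have [t1 e1 l1] := Hp s; have [t2 e2 l2] := Hq (run p s).
  by exists (t1 + t2)%N; [econstructor; eauto|exact: leq_add].
- move=> b p IHp q IHq s /andP[/IHp Hp /IHq Hq].
  case E : (eval_test b s).
    have [t e l] := Hp s; exists t.+1; last by rewrite ltnS leq_max l.
    by constructor; rewrite E.
  have [t e l] := Hq s; exists t.+1; last by rewrite ltnS leq_max l orbT.
  by constructor; rewrite E.
Qed.

Lemma halts_seq p q s c1 s1 c2 s2 :
  halts_within p s c1 s1 -> halts_within q s1 c2 s2 ->
  halts_within (Seq p q) s (c1 + c2) s2.
Proof.
move=> [t1 e1 l1] [t2 e2 l2].
by exists (t1 + t2)%N; [econstructor; eauto|exact: leq_add].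
Qed.

(** The invariant is indexed by the number of iterations left, so one induction gives termination,
    the final state and the cost, including the last failing test. *)
Lemma halts_while b p c (Inv : nat -> state R -> Prop) :
  (forall k s, Inv k.+1 s -> eval_test b s /\
     exists2 s', halts_within p s c s' & Inv k s') ->
  (forall s, Inv 0%N s -> ~~ eval_test b s) ->
  forall k s, Inv k s ->
    exists2 s', halts_within (While b p) s (k * c.+1).+1 s' & Inv 0%N s'.
Proof.
move=> step stop; elim=> [|k IH] s Is.
  by exists s => //; exists 1%N => //; constructor; exact: stop.
have [bs [s1 [t1 e1 l1] Is1]] := step _ _ Is.
have [s2 [t2 e2 l2] Is2] := IH _ Is1.
exists s2 => //; exists (t1 + t2).+1; first by econstructor; eauto.
by rewrite ltnS mulSn addSn -addnS leq_add.
Qed.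

End LoopFreePrograms.

(** * The program *)

Fixpoint block (ps : seq program) : program :=
  if ps is p :: ps' then Seq p (block ps') else Skip.

(* Index registers: n_0 holds the number of vertices, n_1 = 1, n_2 the first
   kept vertex o, n_3 the current vertex, n_9 = 0. Vertices 0 and 1 are copied
   to positions n and n + 1, so that the vertices o, ..., o + n can be
   addressed without reduction modulo n. *)
Definition extend : program := block
  [:: ConstI 1 1; ConstI 9 0;
      ReadA 0 0 9; WriteA 0 0 0; ReadA 0 1 9; WriteA 1 0 0;
      AddI 4 0 1;
      ReadA 0 0 1; WriteA 0 4 0; ReadA 0 1 1; WriteA 1 4 0].

(* Fills A_2[o + 1 .. o + n + 1] with [best weight (o + n)]. *)
Definition table_init : program := block
  [:: AddI 3 2 0; AddI 4 3 1; ConstR 0 0; WriteA 2 3 0; WriteA 2 4 0;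
      AddI 6 2 1; AddI 6 6 1].

(** Moves n_3 from [i + 1] down to [i]. Registers x_2 to x_7 hold the vertices [i + 1], [i],
    [i - 1]; x_8 becomes the value of removing [i], to be compared with x_0, that of keeping it. *)
Definition table_step : program := block
  [:: AddI 4 3 1; ReadA 0 2 3; ReadA 1 2 4; ReadA 2 0 3; ReadA 3 1 3;
      SubI 3 3 1; ReadA 4 0 3; ReadA 5 1 3;
      SubI 5 3 1; ReadA 6 0 5; ReadA 7 1 5;
      OpR SubR 8 4 6; OpR SubR 9 3 7; OpR MulR 8 8 9;
      OpR SubR 9 5 7; OpR SubR 10 2 6; OpR MulR 9 9 10;
      OpR SubR 8 8 9; OpR AddR 8 8 1;
      If (LeR 0 8) (WriteA 2 3 8) (WriteA 2 3 0)].

Definition table : program := Seq table_init (While (LeI 6 3) table_step).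

(** Each run of [table] leaves n_3 at [o + 1], where the optimum for [o] is stored. The second run
    overwrites the first table, which is rebuilt if [o = 0] wins. *)
Definition choose_start : program := block
  [:: ConstI 2 0; table; ReadA 11 2 3; ConstI 2 1; table; ReadA 12 2 3;
      If (LeR 12 11) (Seq (ConstI 2 0) table) Skip].

(* Writes the kept vertices to the front of A_0 and A_1; n_7 counts them, and
   n_8 = 1 if the previous vertex was excluded. *)
Definition output_init : program := block
  [:: AddI 3 2 9; AddI 4 3 1; AddI 6 2 0; ConstI 7 0; ConstI 8 1].

Definition keep : program := block
  [:: ReadA 2 0 3; WriteA 0 7 2; ReadA 2 1 3; WriteA 1 7 2;
      AddI 7 7 1; ConstI 8 0].

Definition output_step : program := block
  [:: ReadA 0 2 3; ReadA 1 2 4;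
      If (LeI 1 8) keep (If (LeR 0 1) keep (ConstI 8 1));
      AddI 3 3 1; AddI 4 4 1].

Definition output : program :=
  Seq output_init (Seq (While (LeI 4 6) output_step) (AddI 0 7 9)).

Definition algorithm : program := block [:: extend; choose_start; output].

Arguments run : simpl never.

Ltac run_simpl := lazy beta iota zeta delta
  [run block updn eqn idx reg arr eval_op eval_test].

(** * Correctness and running time of the program *)

Section Correctness.
Variables (R : realType) (C : seq (R * R)).
Hypothesis convC : convex_polygon C.
Hypothesis C5 : (5 <= size C)%N.
Implicit Types (i j k m o : nat) (s : state R).

Local Notation n := (size C).
Local Notation w := (weight C).

Definition stores_vertex s i j :=
  arr s 0%N i = (vtx C j).1 /\ arr s 1%N i = (vtx C j).2.

Definition extended s :=
  [/\ idx s 0%N = n, idx s 1%N = 1%N, idx s 9%N = 0%N &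
      forall i, (i <= n.+1)%N -> stores_vertex s i i].

Lemma extend_correct s : encodes s C -> extended (run extend s).
Proof.
case: s => fi fr fa [s0 sA]; rewrite /extend; run_simpl.
split=> // i; rewrite /stores_vertex/= /upd.
move: s0 sA => /= s0 sA; rewrite s0 => lei.
have vn : vtx C n = C`_0 by rewrite (vtxDn C 0) vtx_small//; lia.
have vn1 : vtx C n.+1 = C`_1 by rewrite (vtxDn C 1) vtx_small//; lia.
have [n0 n1] : (0 < n)%N /\ (1 < n)%N by split; lia.
have [A00 A10] := sA _ n0; have [A01 A11] := sA _ n1.
have e1 : (1%N == n) = false by apply/negP; lia.
have e0 : (0%N == n) = false by apply/negP; lia.
rewrite addn1; have [->|i1] := eqVneq i n.+1.
  by rewrite ?e1 ?e0 vn1 A01 A11.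
have [->|i2] := eqVneq i n; first by rewrite vn A00 A10.
have ltin : (i < n)%N by lia.
by have [-> ->] := sA _ ltin; rewrite vtx_small.
Qed.

(** Here [k] counts the iterations left, and [x], [y] record that x_11 and x_12, which hold the
    values to be compared, survive the loop. *)
Definition table_inv o (x y : R) k s :=
  [/\ extended s,
      [/\ idx s 2%N = o, idx s 3%N = (o.+1 + k)%N, idx s 6%N = o.+2 &
          (k < n)%N],
      forall j, (o.+1 + k <= j)%N -> (j <= (o + n).+1)%N ->
        arr s 2%N j = best w (o + n) j
    & reg s 11%N = x /\ reg s 12%N = y].

Lemma table_step_correct o x y k s : (o < 2)%N -> table_inv o x y k.+1 s ->
  table_inv o x y k (run table_step s).
Proof.
case: s => fi fr fa o2 [[/= s0 s1 s9 sA] [/= s2 s3 s6 kn] /= sD [/= x11 y12]].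
rewrite /stores_vertex/= in sA.
set i := (o.+1 + k)%N.
have i3 : (o.+1 + k.+1)%N = i.+1 by rewrite /i; lia.
have bi : best w (o + n) i =
    Num.max (best w (o + n) i.+1) (w i + best w (o + n) i.+2).
  by apply: best_rec; rewrite /i; lia.
have D1 : fa 2%N i.+1 = best w (o + n) i.+1.
  by apply: sD; rewrite /i; lia.
have D2 : fa 2%N i.+2 = best w (o + n) i.+2.
  by apply: sD; rewrite /i; lia.
have [A1 B1] := sA i.+1 ltac:(rewrite /i; lia).
have [A2 B2] := sA i ltac:(rewrite /i; lia).
have [A3 B3] := sA i.-1 ltac:(rewrite /i; lia).
have wi : w i = orient (vtx C i.-1) (vtx C i) (vtx C i.+1).
  by rewrite /weight /ear prednK//.
have E : forall s', extended s' -> idx s' 2%N = o -> idx s' 3%N = i ->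
  idx s' 6%N = o.+2 -> arr s' 2%N = upd (fa 2%N) i (best w (o + n) i) ->
  reg s' 11%N = x -> reg s' 12%N = y -> table_inv o x y k s'.
  move=> s' es' h2 h3 h6 hA hx hy; split=> //; first by split=> //; lia.
  move=> j jl ju; rewrite hA /upd; case: eqVneq => [->//|ji].
  by apply: sD => //; rewrite /i in ji; lia.
rewrite /table_step; run_simpl.
rewrite !s1 !s3 !i3 !addn1 !subn1 /= D1 D2 A1 B1 A2 B2 A3 B3.
move: bi; rewrite wi /orient maxEle; case: ifP => _ bi; apply: E => //=.
- by rewrite /updn bi/=.
- by rewrite /updn bi/=.
Qed.

Lemma table_correct o s : (o < 2)%N -> extended s -> idx s 2%N = o ->
  exists2 s', halts_within table s (40 * n) s' &
    table_inv o (reg s 11%N) (reg s 12%N) 0 s'.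
Proof.
move=> o2 es s2.
have H0 : table_inv o (reg s 11%N) (reg s 12%N) n.-1 (run table_init s).
  case: s es s2 => fi fr fa [/= s0 s1 s9 sA] /= s2.
  rewrite /table_init; run_simpl; rewrite s0 s1 s2.
  split=> //=; first by split=> //=; lia.
  move=> j jl ju; rewrite /updn/= /upd; rewrite best_ge; last lia.
  case: eqP => // j1; case: eqP => // j2; lia.
move: (reg s 11%N) (reg s 12%N) H0 => x y H0.
have step k s1 : table_inv o x y k.+1 s1 -> eval_test (LeI 6 3) s1 /\
    exists2 s', halts_within table_step s1 (cost table_step) s' &
      table_inv o x y k s'.
  move=> I; split; first by case: I => _ [_ /= -> ->]; lia.
  exists (run table_step s1); first exact: halts_run.
  exact: table_step_correct.
have stop s1 : table_inv o x y 0 s1 -> ~~ eval_test (LeI 6 3) s1.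
  by case=> _ [_ /= -> ->]; lia.
have [s' hs' Is'] := halts_while step stop H0.
exists s' => //.
have [t ht le] := halts_seq (@halts_run _ table_init s isT) hs'.
exists t => //; apply: (leq_trans le).
rewrite [cost table_init]/= [cost table_step]/=; lia.
Qed.

Lemma choose_start_correct s : extended s ->
  exists o s', [/\ halts_within choose_start s (130 * n) s', (o < 2)%N,
    value C o = Num.max (value C 0) (value C 1) &
    exists x y, table_inv o x y 0 s'].
Proof.
move=> es.
have atom p s1 : loop_free p -> cost p = 1%N -> halts_within p s1 1 (run p s1).
  by move=> lp cp; have := halts_run s1 lp; rewrite cp.
set s1 := run (ConstI 2 0) s.
have h1 : halts_within (ConstI 2 0) s 1 s1 by exact: atom.
have es1 : extended s1 by case: es.
have [s2 h2 I2] := table_correct (isT : (0 < 2)%N) es1 erefl.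
have v0 : arr s2 2%N (idx s2 3%N) = value C 0.
  by case: I2 => _ [_ -> _ _] -> //; lia.
set s3 := run (ReadA 11 2 3) s2.
have h3 : halts_within (ReadA 11 2 3) s2 1 s3 by exact: atom.
set s4 := run (ConstI 2 1) s3.
have h4 : halts_within (ConstI 2 1) s3 1 s4 by exact: atom.
have es4 : extended s4 by case: I2 => -[].
have [s5 h5 I5] := table_correct (isT : (1 < 2)%N) es4 erefl.
have r11 : reg s5 11%N = value C 0.
  by case: I5 => _ _ _ [-> _]; rewrite -v0.
have v1 : arr s5 2%N (idx s5 3%N) = value C 1.
  by case: I5 => _ [_ -> _ _] -> //; lia.
set s6 := run (ReadA 12 2 3) s5.
have h6 : halts_within (ReadA 12 2 3) s5 1 s6 by exact: atom.
have test : eval_test (LeR 12 11) s6 = (value C 1 <= value C 0).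
  by rewrite -r11 -v1.
pose last := If (LeR 12 11) (Seq (ConstI 2 0) table) Skip.
suff : exists o s7,
    [/\ halts_within last s6 (1 + 40 * n).+1 s7, (o < 2)%N,
    value C o = Num.max (value C 0) (value C 1) &
    exists x y, table_inv o x y 0 s7].
  case=> a [s7 [h7 a2 va I7]]; exists a, s7; split=> //.
  have h8 : halts_within Skip s7 0 s7 by exact: (@halts_run _ Skip).
  have := halts_seq h1 (halts_seq h2 (halts_seq h3 (halts_seq h4
    (halts_seq h5 (halts_seq h6 (halts_seq h7 h8)))))).
  by move=> [t ht le]; exists t => //; apply: (leq_trans le); lia.
have [le|lt] := leP (value C 1) (value C 0).
  set s7 := run (ConstI 2 0) s6.
  have h7 : halts_within (ConstI 2 0) s6 1 s7 by exact: atom.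
  have es7 : extended s7 by case: I5 => -[].
  have [s8 h8 I8] := table_correct (isT : (0 < 2)%N) es7 erefl.
  exists 0%N, s8; split=> //; last by do 2 eexists; exact: I8.
  have [t ht tle] := halts_seq h7 h8.
  by exists t.+1 => //; constructor; rewrite test le.
exists 1%N, s6; split=> //.
  by exists 1%N => //; constructor; rewrite test leNgt lt; constructor.
by do 2 eexists; case: I5 => -[e0 e1 e9 eA] I D _; split.
Qed.

(** The arrays serve for input and output at once: the kept vertices found so far fill the front,
    and the unread vertices from [o + m] on are intact. *)
Definition output_inv o m s :=
  let J := kept (best w (o + n)) o m in
  [/\ [/\ idx s 1%N = 1%N, idx s 9%N = 0%N, idx s 3%N = (o + m)%N,
           idx s 4%N = (o + m).+1 & idx s 6%N = (o + n)%N],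
      idx s 7%N = size J /\ idx s 8%N = skip (best w (o + n)) o m,
      forall j, (o < j)%N -> (j <= o + n)%N -> arr s 2%N j = best w (o + n) j,
      forall i, (o + m <= i)%N -> (i <= n.+1)%N -> stores_vertex s i i
    & forall l, (l < size J)%N -> stores_vertex s l (o + nth 0%N J l)].

Lemma output_step_correct o m s : (o < 2)%N -> (m < n)%N ->
  output_inv o m s -> output_inv o m.+1 (run output_step s).
Proof.
move=> o2 mn; set D := best w (o + n).
pose J := kept D o.
have Jle k : (size (J k) <= k)%N.
  by rewrite size_filter -[k in (_ <= k)%N](size_iota 0 k) count_size.
have JS k : J k.+1 = if skip D o k.+1 then J k else rcons (J k) k.
  have iotaS : iota 0 k.+1 = iota 0 k ++ [:: k] by rewrite -addn1 iotaD.
  rewrite /J /kept iotaS filter_cat/=.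
  by case: (skip D o k.+1); rewrite /= ?cats0 ?cats1.
case: s => fi fr fa [[/= s1 s9 s3 s4 s6] [/= s7 s8] /= sD].
rewrite /stores_vertex/= => sA sJ.
rewrite -/D -/(J m) in s7 s8 sD sJ.
have test : skip D o m.+1 =
    if (1 <= fi 8%N)%N then false
    else ~~ (fa 2%N (fi 3%N) <= fa 2%N (fi 4%N)).
  rewrite skipS s8; case: m mn s3 s4 {s7 s8 sA sJ} => [//|m] mn s3 s4.
  case: (skip D o m.+1) => //=; rewrite s3 s4 !sD ?ltNge//; lia.
have [A0 A1] := sA (o + m)%N (leqnn _) ltac:(lia).
pose s' := run (block [:: ReadA 0 2 3; ReadA 1 2 4]) (State fi fr fa).
pose next := block [:: AddI 3 3 1; AddI 4 4 1].
have -> : run output_step (State fi fr fa) = run next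
    (if (fi 1%N <= fi 8%N)%N then run keep s'
     else if fa 2%N (fi 3%N) <= fa 2%N (fi 4%N) then run keep s'
     else run (ConstI 8 1) s') by [].
have -> : (if (fi 1%N <= fi 8%N)%N then run keep s'
     else if fa 2%N (fi 3%N) <= fa 2%N (fi 4%N) then run keep s'
     else run (ConstI 8 1) s') =
    if skip D o m.+1 then run (ConstI 8 1) s' else run keep s'.
  by rewrite test s1; case: (1 <= fi 8%N)%N => //; case: (_ <= _).
have invI st :
    [/\ idx st 1%N = 1%N, idx st 9%N = 0%N, idx st 3%N = (o + m).+1,
        idx st 4%N = (o + m).+2 & idx st 6%N = (o + n)%N] ->
    idx st 7%N = size (J m.+1) -> idx st 8%N = skip D o m.+1 ->
    arr st 2%N = fa 2%N ->
    (forall i, (o + m < i)%N -> (i <= n.+1)%N -> stores_vertex st i i) ->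
    (forall l, (l < size (J m.+1))%N ->
      stores_vertex st l (o + nth 0%N (J m.+1) l)) ->
    output_inv o m.+1 st.
  move=> st1 st7 st8 st2 stA stJ; split; rewrite -/D -/(J m.+1) ?addnS//.
  by rewrite st2.
rewrite {}/s' {}/next {test}; case: (boolP (skip D o m.+1)) => sm.
  run_simpl; rewrite s1 s3 s4 !addn1; apply: invI; rewrite ?JS ?sm//=.
  by move=> i il iu; apply: sA => //; exact: ltnW.
rewrite /keep; run_simpl; rewrite s1 s3 s4 s7 A0 A1 !addn1.
apply: invI; rewrite ?JS ?(negPf sm)//=.
- by rewrite size_rcons.
(* The cell written has index [size (J m) <= m], so it precedes all unread vertices. *)
- move=> i il iu; rewrite /stores_vertex/= /updn/= /upd ifF.
    by rewrite ifF; [apply: sA; lia|apply/negP; have := Jle m; lia].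
  by apply/negP; have := Jle m; lia.
- move=> l; rewrite size_rcons ltnS => lJ; rewrite /stores_vertex/= /updn/= /upd.
  rewrite nth_rcons; case: eqVneq => [->|lJ']; first by rewrite ltnn.
  have lJm : (l < size (J m))%N by lia.
  by rewrite lJm; exact: sJ.
Qed.

Lemma output_correct o x y s : (o < 2)%N -> table_inv o x y 0 s ->
  exists2 s', halts_within output s (20 * n) s' &
    encodes s' (kept_polygon C (best w (o + n)) o).
Proof.
move=> o2 I; set D := best w (o + n).
have H0 : output_inv o 0 (run output_init s).
  case: s I => fi fr fa [[/= s0 s1 s9 sA] [/= s2 s3 s6 _] /= sD _].
  rewrite /output_init; run_simpl; rewrite s0 s1 s2 s9.
  split=> //=.
  - by split=> //; lia.
  - by move=> j jl ju; apply: sD; lia.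
  - by move=> i _; exact: sA.
pose Inv k s1 := (k <= n)%N /\ output_inv o (n - k) s1.
have step k s1 : Inv k.+1 s1 -> eval_test (LeI 4 6) s1 /\
    exists2 s', halts_within output_step s1 (cost output_step) s' & Inv k s'.
  move=> [kn I1]; split; first by case: I1 => -[_ _ _ /= -> ->] _ _ _ _; lia.
  exists (run output_step s1); first exact: halts_run.
  split; first exact: ltnW; have -> : (n - k = (n - k.+1).+1)%N by lia.
  by apply: output_step_correct => //; lia.
have stop s1 : Inv 0%N s1 -> ~~ eval_test (LeI 4 6) s1.
  by case=> _ [[_ _ _ /= -> ->] _ _ _ _]; lia.
have Hn : Inv n (run output_init s) by rewrite /Inv subnn.
have [s1 h1 [_ I1]] := halts_while step stop Hn.
exists (run (AddI 0 7 9) s1).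
  have := halts_seq (@halts_run _ output_init s isT)
    (halts_seq h1 (@halts_run _ (AddI 0 7 9) s1 isT)).
  move=> [t ht le]; exists t => //; apply: (leq_trans le).
  rewrite [cost output_init]/= [cost output_step]/= [cost (AddI _ _ _)]/=; lia.
move: I1; rewrite subn0 => -[[_ s9 _ _ _] [s7 _] _ _ sJ].
case: s1 {h1} s7 s9 sJ => fi fr fa /= s7 s9 sJ.
rewrite /kept_polygon; run_simpl; split; first by rewrite /= s7 s9 addn0 size_map.
move=> i; rewrite size_map => iJ; rewrite (nth_map 0%N)//; exact: sJ.
Qed.

Lemma algorithm_correct s : encodes s C ->
  exists s' Q, [/\ halts_within algorithm s (200 * n) s', encodes s' Q &
    min_area_inscribed Q C].
Proof.
move=> /extend_correct es; have h1 := @halts_run _ extend s isT.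
have [a [s2 [h2 a2 va [x [y I2]]]]] := choose_start_correct es.
have [s3 h3 K] := output_correct a2 I2.
exists s3, (kept_polygon C (best w (a + n)) a); split=> //.
  have h4 : halts_within Skip s3 0 s3 by exact: (@halts_run _ Skip).
  have [t ht le] := halts_seq h1 (halts_seq h2 (halts_seq h3 h4)).
  by exists t => //; apply: (leq_trans le); rewrite [cost extend]/=; lia.
exact: kept_polygon_min.
Qed.

End Correctness.

Theorem mainTheorem1 (R : realType) :
  exists (p : program) (K : nat),
    forall (n : nat) (C : seq (R * R)) (s : state R),
      (5 <= n)%N -> size C = n -> convex_polygon C -> encodes s C ->
      exists (t : nat) (s' : state R) (Q : seq (R * R)),
        [/\ exec p s t s', (t <= K * n)%N,
            encodes s' Q & min_area_inscribed Q C].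
Proof.
(* At most three table runs of [40 * n] steps fit into [130 * n], and the output takes at most
   [20 * n]; the rest of 200 generously covers [extend]. *)
exists algorithm, 200%N => n C s n5 sC convC sE.
rewrite -sC in n5 *.
have [s' [Q [[t ht le] QE Qmin]]] := algorithm_correct convC n5 sE.
by exists t, s', Q.
Qed.
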